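(* The problem \textsc{Prescribed Foremost-path TGR} can be solved in $\mathcal{O}(n^3\log n)$ time and $\mathcal{O}(n^2)$ space. Furthermore, if the instance is realizable, a realization with at most $n^2$ time labels in total can be computed within the same time and space bounds.
   Context: A temporal graph $\mathcal{G}=(G,\lambda)$ consists of a static undirected graph $G=(V,E)$ (its underlying graph) with $V=[n]$ and a labeling $\lambda:E\to 2^{\mathbb{N}_{>0}}$ assigning to each edge the (finite) set of positive times at which it appears; the number of time labels is $\sum_e|\lambda(e)|$. A strict temporal $uv$-path is a path $u=v_0,\dots,v_k=v$ in $G$ with distinct vertices and times $\tau_1<\dots<\tau_k$, $\tau_i\in\lambda(\{v_{i-1},v_i\})$; its arrival time is $\tau_k$. $\mathrm{Fo}(\mathcal{G})$ is the $n\times n$ matrix with diagonal $0$ and entry $(u,v)$, $u\ne v$, the minimum arrival time of a strict temporal $uv$-path ($\infty$ if none). A distance matrix is an $n\times n$ matrix with entries in $\mathbb{N}\cup\{\infty\}$, zero exactly on the diagonal. \textsc{Prescribed Foremost-path TGR}: given $n$, an $n\times n$ distance matrix $D$ and a static graph $G_p=([n],E_p)$, decide whether there exists a temporal graph $\mathcal{G}=(G,\lambda)$ on $[n]$ with $\mathrm{Fo}(\mathcal{G})=D$ and $G$ a subgraph of $G_p$. *)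

(* Defs.v *)
From mathcomp Require Import all_boot matrix finmap boolp.

Set Implicit Arguments.
Unset Strict Implicit.
Unset Printing Implicit Defensive.

(** * Word RAM

    A machine has a finite program, registers, a random access memory and a
    write-only output; registers and memory cells hold [w]-bit words.  Every
    instruction takes one unit of time.  A program mentions only finitely many
    registers, so the space used is measured by the memory alone. *)

Inductive instr : Type :=
| IConst (d k : nat)
| IAdd (d a b : nat)
| ISub (d a b : nat)
| IMul (d a b : nat)
| IDiv (d a b : nat)
| IGet (d a : nat)
| IPut (a b : nat)
| IJump (l : nat)
| IJlt (a b l : nat)
| IPrint (a : nat)
| IHalt.

Definition program := seq instr.

Record config := Config {
  cpc : nat;
  cregs : nat -> nat;
  cmem : nat -> nat;
  cout : seq nat
}.

Definition fetch (P : program) (c : config) : instr := nth IHalt P (cpc c).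

Definition set_reg (w : nat) (c : config) (d x : nat) : config :=
  Config (cpc c).+1 [eta cregs c with d |-> x %% 2 ^ w] (cmem c) (cout c).

(** [None] means that the machine has halted or has accessed a memory cell
    beyond the [s] available ones; the two are told apart by [fetch]. *)
Definition step (w s : nat) (P : program) (c : config) : option config :=
  let r := cregs c in
  match fetch P c with
  | IConst d k => Some (set_reg w c d k)
  | IAdd d a b => Some (set_reg w c d (r a + r b))
  | ISub d a b => Some (set_reg w c d (r a - r b))
  | IMul d a b => Some (set_reg w c d (r a * r b))
  | IDiv d a b => Some (set_reg w c d (r a %/ r b))
  | IGet d a => if r a < s then Some (set_reg w c d (cmem c (r a))) else None
  | IPut a b =>
      if r a < s then
        Some (Config (cpc c).+1 r [eta cmem c with r a |-> r b] (cout c))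
      else None
  | IJump l => Some (Config l r (cmem c) (cout c))
  | IJlt a b l =>
      Some (Config (if r a < r b then l else (cpc c).+1) r (cmem c) (cout c))
  | IPrint a => Some (Config (cpc c).+1 r (cmem c) (rcons (cout c) (r a)))
  | IHalt => None
  end.

(** The input occupies the first memory cells; all else is initially zero. *)
Definition init (x : seq nat) : config :=
  Config 0 (fun=> 0) (fun i => nth 0 x i) [::].

(** With [w]-bit words and [s] memory cells (those of the input included),
    [P] halts on input [x] after at most [t] steps with output [y]. *)
Definition runs_within (w t s : nat) (P : program) (x y : seq nat) : Prop :=
  size x <= s /\
  exists k c, [/\ k <= t,
    iter k (obind (step w s P)) (Some (init x)) = Some c,
    fetch P c = IHalt &
    cout c = y].

Definition bigO (f g : nat -> nat) : Prop :=
  exists c n0, forall n, n0 <= n -> f n <= c * g n.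

(** A word holds a constant factor times the number of bits needed for the
    input length and the largest input number. *)
Definition word_length_ok (c w : nat) (x : seq nat) : Prop :=
  (size x + \max_(a <- x) a + 2) ^ c <= 2 ^ w.

(** Some program computes, on every instance satisfying [dom], an output
    related to the instance by [R], in time O(f) and space O(g) with respect to
    the size parameter [sz] of the instance. *)
Definition computable_in (I : Type) (sz : I -> nat) (enc : I -> seq nat)
    (dom : I -> Prop) (R : I -> seq nat -> Prop) (f g : nat -> nat) : Prop :=
  exists (P : program) (c : nat) (t s : nat -> nat),
    [/\ bigO t f, bigO s g &
      forall (x : I) (w : nat), dom x -> word_length_ok c w (enc x) ->
        exists2 y, runs_within w (t (sz x)) (s (sz x)) P (enc x) y & R x y].

(** * Temporal graphs *)

Record graph (n : nat) := Graph {
  edges : {set {set 'I_n}};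
  edges_card2 : forall e, e \in edges -> #|e| = 2
}.

(** Only the values of [label] on edges are meaningful. *)
Record temporal_graph (n : nat) := TemporalGraph {
  underlying : graph n;
  label : {set 'I_n} -> {fset nat};
  label_pos : forall e t, e \in edges underlying -> t \in label e -> 0 < t
}.

Definition num_labels n (G : temporal_graph n) : nat :=
  \sum_(e in edges (underlying G)) #|` label G e|%fset.

(** [p] lists the pairs (v_1, tau_1), ..., (v_k, tau_k), and v_0 = u. *)
Definition strict_temporal_path n (G : temporal_graph n) (u v : 'I_n)
    (p : seq ('I_n * nat)) : Prop :=
  let vs := u :: unzip1 p in
  let ts := unzip2 p in
  [/\ uniq vs, last u vs = v, sorted ltn ts &
    forall i, i < size p ->
      let e := [set nth u vs i; nth u vs i.+1] in
      e \in edges (underlying G) /\ nth 0 ts i \in label G e].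

Definition arrival_time n (p : seq ('I_n * nat)) : nat := last 0 (unzip2 p).

Definition arrives_at n (G : temporal_graph n) (u v : 'I_n) (t : nat) : Prop :=
  exists2 p, strict_temporal_path G u v p & arrival_time p = t.

(** The least element of a set of natural numbers, [None] (infinity) if it is
    empty. *)
Definition min_time (A : nat -> Prop) : option nat :=
  if pselect (exists t, `[< A t >]) is left h then Some (ex_minn h) else None.

(** Entries in N with infinity are of type [option nat], [None] being
    infinity. *)
Definition Fo n (G : temporal_graph n) : 'M[option nat]_n :=
  \matrix_(u, v) (if u == v then Some 0%N else min_time (arrives_at G u v)).

Definition distance_matrix n (D : 'M[option nat]_n) : Prop :=
  forall u v, D u v = Some 0 <-> u = v.

(** * The problem *)

Record instance := Instance {
  inst_n : nat;
  inst_D : 'M[option nat]_inst_n;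
  inst_dist : distance_matrix inst_D;
  inst_Gp : graph inst_n
}.

Definition realization (x : instance) (G : temporal_graph (inst_n x)) : Prop :=
  Fo G = inst_D x /\ edges (underlying G) \subset edges (inst_Gp x).

Definition realizable (x : instance) : Prop := exists G, realization (x := x) G.

(** Infinity is encoded by 0 and the number k by k + 1. *)
Definition enc_entry (d : option nat) : nat := oapp S 0 d.

(** The number n, then D, then the adjacency matrix of G_p, both row by row. *)
Definition enc_instance (x : instance) : seq nat :=
  let I := enum 'I_(inst_n x) in
  inst_n x :: [seq enc_entry (inst_D x u v) | u <- I, v <- I]
    ++ [seq nat_of_bool ([set u; v] \in edges (inst_Gp x)) | u <- I, v <- I].

Definition correct_decision (x : instance) (y : seq nat) : Prop :=
  (realizable x -> y = [:: 1]) /\ (~ realizable x -> y = [:: 0]).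

(** [y] lists without repetition the triples u, v, t with u < v and t a label
    of the edge uv.  The underlying graph can be read off from [y] because
    every edge has a label. *)
Definition encodes_temporal_graph n (G : temporal_graph n) (y : seq nat) :=
  (forall e, e \in edges (underlying G) -> label G e <> fset0) /\
  exists s : seq ('I_n * 'I_n * nat),
    [/\ uniq s,
      forall u v t, ((u, v, t) \in s) =
        [&& u < v, [set u; v] \in edges (underlying G)
          & t \in label G [set u; v]] &
      y = flatten [seq [:: nat_of_ord a.1.1; nat_of_ord a.1.2; a.2] | a <- s]].

Definition correct_realization (x : instance) (y : seq nat) : Prop :=
  exists G : temporal_graph (inst_n x),
    [/\ realization G, num_labels G <= inst_n x ^ 2 &
      encodes_temporal_graph G y].

(* Main.v *)
Require Import Defs.
From mathcomp Require Import all_boot zify matrix finmap boolp.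

(** Call a label t of an edge vw of G_p admissible if no y has one of D(y,v),
    D(y,w) smaller and the other larger than t.  The labels of a realization are
    admissible, and conversely admissible labels never create an arrival earlier
    than D.  Looking at the last edge of a foremost path, the instance is
    realizable iff every finite D(x,v) with x <> v has a neighbour w of v in G_p
    with D(x,w) < D(x,v) such that D(x,v) is admissible for vw; keeping one such
    w per pair (x,v) gives a realization with at most n^2 labels.

    For a fixed pair (v,w), admissibility of all the D(x,v) is tested in linear
    time: the condition on the y with D(y,v) < D(x,v) bounds the maximum of
    D(y,w) over these y, a prefix maximum once the y are put into buckets by the
    rank of D(y,v) in its column; the other condition is the same one for the
    complemented matrix B - D.  Ranks are found by counting in O(n^3).

    The program is written in a small language whose only loops run over
    0, ..., n - 1 and whose only mutable data are n x n matrices, so that its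
    running time is bounded by its loop depth. *)

Set Implicit Arguments.
Unset Strict Implicit.
Unset Printing Implicit Defensive.

(** * A structured language and its compiler *)

(* Variables are immutable and numbered in order of binding, outermost first;
   [Var 0] is n.  [Get a e1 e2] is the entry [(e1, e2)] of matrix number [a]. *)
Inductive expr : Type :=
| Var (i : nat)
| Cst (k : nat)
| Add (e1 e2 : expr)
| Dif (e1 e2 : expr)
| Get (a : nat) (e1 e2 : expr).

Inductive cmd : Type :=
| Skip
| Store (a : nat) (e1 e2 e3 : expr)
| Seq (c1 c2 : cmd)
| If (e1 e2 : expr) (c1 c2 : cmd)
| For (c : cmd)
| Let (e : expr) (c : cmd)
| Print (e : expr).

Definition arrays := nat -> nat -> nat -> nat.

Definition upd (m : arrays) (a i j x : nat) : arrays := fun a' i' j' =>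
  if [&& a' == a, i' == i & j' == j] then x else m a' i' j'.

Fixpoint eval (env : seq nat) (m : arrays) (e : expr) : nat :=
  match e with
  | Var i => nth 0 env i
  | Cst k => k
  | Add e1 e2 => eval env m e1 + eval env m e2
  | Dif e1 e2 => eval env m e1 - eval env m e2
  | Get a e1 e2 => m a (eval env m e1) (eval env m e2)
  end.

(** Conditions under which word arithmetic agrees with [eval] and every access stays within the [K]
    matrices. Truncated subtraction cannot overflow, so [Dif] only needs safe operands. *)
Fixpoint safe (W K n : nat) (env : seq nat) (m : arrays) (e : expr) : bool :=
  match e with
  | Var i => i < size env
  | Cst k => k < W
  | Add e1 e2 => [&& safe W K n env m e1, safe W K n env m e2
                   & eval env m e1 + eval env m e2 < W]
  | Dif e1 e2 => safe W K n env m e1 && safe W K n env m e2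
  | Get a e1 e2 => [&& safe W K n env m e1, safe W K n env m e2, a < K,
                       eval env m e1 < n & eval env m e2 < n]
  end.

(** A predicate transformer by recursion on the command. A loop asks for an invariant indexed by the
    number of completed rounds; as loops are bounded, termination needs no separate argument. *)
Fixpoint wp (W K n : nat) (c : cmd) (env : seq nat)
    (Q : arrays -> seq nat -> Prop) (m : arrays) (o : seq nat) : Prop :=
  match c with
  | Skip => Q m o
  | Store a e1 e2 e3 =>
      [&& safe W K n env m (Get a e1 e2) & safe W K n env m e3] /\
      Q (upd m a (eval env m e1) (eval env m e2) (eval env m e3)) o
  | Seq c1 c2 => wp W K n c1 env (wp W K n c2 env Q) m o
  | If e1 e2 c1 c2 =>
      safe W K n env m e1 && safe W K n env m e2 /\
      if eval env m e1 < eval env m e2 then wp W K n c1 env Q m o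
      else wp W K n c2 env Q m o
  | For c1 =>
      exists I : nat -> arrays -> seq nat -> Prop,
        [/\ I 0 m o,
            forall i m' o', i < n -> I i m' o' ->
              wp W K n c1 (rcons env i) (I i.+1) m' o' &
            forall m' o', I n m' o' -> Q m' o']
  | Let e c1 => safe W K n env m e /\ wp W K n c1 (rcons env (eval env m e)) Q m o
  | Print e => safe W K n env m e /\ Q m (rcons o (eval env m e))
  end.

(* Matrix [a] starts at memory cell [1 + a * n * n], which agrees with the layout
   of the input for [a = 0] and [a = 1]. *)
Definition idx (a d : nat) : seq instr :=
  [:: IConst d.+2 a; IMul d.+2 d.+2 0; IAdd d d d.+2; IMul d d 0;
      IAdd d d d.+1; IConst d.+1 1; IAdd d d d.+1].

Arguments idx : simpl never.

(* Variable [i] lives in register [i < d]; the value is left in register [d], and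
   the registers above [d] are scratch. *)
Fixpoint cexpr (e : expr) (d : nat) : seq instr :=
  match e with
  | Var i => [:: IConst d 0; IAdd d d i]
  | Cst k => [:: IConst d k]
  | Add e1 e2 => cexpr e1 d ++ cexpr e2 d.+1 ++ [:: IAdd d d d.+1]
  | Dif e1 e2 => cexpr e1 d ++ cexpr e2 d.+1 ++ [:: ISub d d d.+1]
  | Get a e1 e2 => cexpr e1 d ++ cexpr e2 d.+1 ++ idx a d ++ [:: IGet d d]
  end.

(** Jumps are absolute, hence the address [p] of the block. [d] is the first free register, that is,
    the number of variables in scope; a loop keeps its counter there and compares it with register
    0, which holds n. *)
Fixpoint code (p : nat) (c : cmd) (d : nat) : seq instr :=
  match c with
  | Skip => [::]
  | Store a e1 e2 e3 =>
      cexpr e1 d ++ cexpr e2 d.+1 ++ idx a d ++ cexpr e3 d.+1 ++ [:: IPut d d.+1]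
  | Seq c1 c2 => let k1 := code p c1 d in k1 ++ code (p + size k1) c2 d
  | If e1 e2 c1 c2 =>
      let t := cexpr e1 d ++ cexpr e2 d.+1 in
      let p2 := (p + size t).+1 in
      let k2 := code p2 c2 d in
      let p1 := (p2 + size k2).+1 in
      let k1 := code p1 c1 d in
      t ++ IJlt d d.+1 p1 :: k2 ++ IJump (p1 + size k1) :: k1
  | For c1 =>
      let k := code p.+3 c1 d.+1 in
      [:: IConst d 0; IJlt d 0 p.+3; IJump (p + size k).+3.+3] ++ k ++
      [:: IConst d.+1 1; IAdd d d d.+1; IJump p.+1]
  | Let e c1 => cexpr e d ++ code (p + size (cexpr e d)) c1 d.+1
  | Print e => cexpr e d ++ [:: IPrint d]
  end.

(** A conditional is charged for both branches. Each round of a loop adds 4 steps (test, two for the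
    increment, jump back); the final 3 are the initialization, the failing test and the exit
    jump. *)
Fixpoint cost (n : nat) (c : cmd) (d : nat) : nat :=
  match c with
  | Skip => 0
  | Store a e1 e2 e3 =>
      size (cexpr e1 d) + size (cexpr e2 d.+1) + size (cexpr e3 d.+1) + 8
  | Seq c1 c2 => cost n c1 d + cost n c2 d
  | If e1 e2 c1 c2 =>
      size (cexpr e1 d) + size (cexpr e2 d.+1) + (cost n c1 d + cost n c2 d) + 2
  | For c1 => n * (cost n c1 d.+1 + 4) + 3
  | Let e c1 => size (cexpr e d) + cost n c1 d.+1
  | Print e => size (cexpr e d) + 1
  end.

Fixpoint depth (c : cmd) : nat :=
  match c with
  | Seq c1 c2 | If _ _ c1 c2 => maxn (depth c1) (depth c2)
  | For c1 => (depth c1).+1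
  | Let _ c1 => depth c1
  | _ => 0
  end.

(** Induction on the command, each loop contributing one factor. The base [n.+1] is positive even
    for n = 0, so additive constants are absorbed into [k]. *)
Lemma cost_bound c d : exists k, forall n, cost n c d <= k * n.+1 ^ depth c.
Proof.
have X n p q : n.+1 ^ p <= n.+1 ^ maxn p q by rewrite leq_pexp2l ?leq_maxl.
have Y n p q : n.+1 ^ q <= n.+1 ^ maxn p q by rewrite maxnC.
have Z n p : 0 < n.+1 ^ p by rewrite expn_gt0.
elim: c d => [|a e1 e2 e3|c1 IH1 c2 IH2|e1 e2 c1 IH1 c2 IH2|c1 IH|e c1 IH|e] d.
- by exists 0.
- by eexists => n /=; rewrite expn0 muln1.
- have [k1 h1] := IH1 d; have [k2 h2] := IH2 d; exists (k1 + k2) => n /=.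
  rewrite mulnDl leq_add //; first exact: leq_trans (h1 n) (leq_mul _ (X _ _ _)).
  exact: leq_trans (h2 n) (leq_mul _ (Y _ _ _)).
- have [k1 h1] := IH1 d; have [k2 h2] := IH2 d.
  exists (size (cexpr e1 d) + size (cexpr e2 d.+1) + (k1 + k2) + 2) => n /=.
  rewrite mulnDl leq_add //; last by rewrite leq_pmulr.
  rewrite mulnDl leq_add //; first by rewrite leq_pmulr.
  rewrite mulnDl leq_add //; first exact: leq_trans (h1 n) (leq_mul _ (X _ _ _)).
  exact: leq_trans (h2 n) (leq_mul _ (Y _ _ _)).
- have [k h] := IH d.+1; exists (k + 7) => n /=; rewrite expnS.
  by move: (h n) (Z n (depth c1)); move: (_ ^ _) => z; nia.
- have [k h] := IH d.+1; exists (size (cexpr e d) + k) => n /=.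
  by rewrite mulnDl leq_add // leq_pmulr.
- by eexists => n /=; rewrite expn0 muln1.
Qed.

Definition code_at (P : program) (p : nat) (l : seq instr) : Prop :=
  forall i, i < size l -> nth IHalt P (p + i) = nth IHalt l i.

Lemma code_at_cat P p l1 l2 :
  code_at P p (l1 ++ l2) <-> code_at P p l1 /\ code_at P (p + size l1) l2.
Proof.
split=> [h|[h1 h2] i].
  split=> i hi; last first.
    rewrite -addnA h ?size_cat; last by lia.
    by rewrite nth_cat ltnNge leq_addr /= addKn.
  by rewrite h ?size_cat ?nth_cat ?hi //; lia.
rewrite size_cat nth_cat => hi; case: ltnP => hs; first exact: h1.
by rewrite -h2 -?addnA ?subnKC //; lia.
Qed.

Lemma code_at_cons P p i l :
  code_at P p (i :: l) <-> nth IHalt P p = i /\ code_at P p.+1 l.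
Proof.
rewrite -cat1s code_at_cat addn1; split=> -[h1 h2]; split=> //.
  by have := h1 0 isT; rewrite addn0.
by case=> // _; rewrite addn0.
Qed.

(** * Simulation of the structured language on the word RAM *)

Section Simulation.

Variables (w s K n : nat).
Local Notation W := (2 ^ w).
Hypothesis s_def : s = 1 + K * n * n.
Hypothesis s_le : s < W.
Hypothesis n_lt : n < W.

Definition addr (a i j : nat) : nat := 1 + ((a * n + i) * n + j).

Lemma addr_lt a i j : a < K -> i < n -> j < n -> addr a i j < s.
Proof.
rewrite s_def /addr => ha hi hj.
have h1 : a * n + i < K * n by nia.
by move: (a * n + i) (K * n) h1 => x y; nia.
Qed.

(** Up to the offset 1, an address has last base-n digits [i] and [j] with [a] in front; division by
    n recovers them. *)
Lemma addr_inj a i j a' i' j' : i < n -> j < n -> i' < n -> j' < n ->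
  (addr a i j == addr a' i' j') = [&& a == a', i == i' & j == j'].
Proof.
move=> hi hj hi' hj'; apply/eqP/and3P; last by case=> /eqP-> /eqP-> /eqP->.
have digits q k q' k' : k < n -> k' < n -> q * n + k = q' * n + k' ->
    q = q' /\ k = k'.
  move=> hk hk' E; have n0 : 0 < n by lia.
  have := congr1 (divn^~ n) E; rewrite /= !divnMDl // !divn_small // !addn0 => Eq.
  by move: E; rewrite Eq => /addnI.
by move=> /addnI/(digits _ _ _ _ hj hj')[/(digits _ _ _ _ hi hi')[-> ->] ->].
Qed.

Definition runs (P : program) (k : nat) (c c' : config) : Prop :=
  iter k (obind (step w s P)) (Some c) = Some c'.

Lemma runs0 P c : runs P 0 c c. Proof. by []. Qed.

Lemma runs_trans P k1 k2 c1 c2 c3 :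
  runs P k1 c1 c2 -> runs P k2 c2 c3 -> runs P (k1 + k2) c1 c3.
Proof. by rewrite /runs addnC iterD => ->. Qed.

Lemma runsS P k c1 c2 c3 :
  step w s P c1 = Some c2 -> runs P k c2 c3 -> runs P k.+1 c1 c3.
Proof. by move=> h; apply: (@runs_trans P 1 k); rewrite /runs /= h. Qed.

Lemma step_const P p r M o d k : nth IHalt P p = IConst d k -> k < W ->
  step w s P (Config p r M o) = Some (Config p.+1 [eta r with d |-> k] M o).
Proof. by rewrite /step /fetch /= => -> h; rewrite /set_reg modn_small. Qed.

Lemma step_add P p r M o d a b : nth IHalt P p = IAdd d a b -> r a + r b < W ->
  step w s P (Config p r M o) = Some (Config p.+1 [eta r with d |-> r a + r b] M o).
Proof. by rewrite /step /fetch /= => -> h; rewrite /set_reg modn_small. Qed.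

Lemma step_sub P p r M o d a b : nth IHalt P p = ISub d a b -> r a < W ->
  step w s P (Config p r M o) = Some (Config p.+1 [eta r with d |-> r a - r b] M o).
Proof. by rewrite /step /fetch /= => -> h; rewrite /set_reg modn_small //; lia. Qed.

Lemma step_mul P p r M o d a b : nth IHalt P p = IMul d a b -> r a * r b < W ->
  step w s P (Config p r M o) = Some (Config p.+1 [eta r with d |-> r a * r b] M o).
Proof. by rewrite /step /fetch /= => -> h; rewrite /set_reg modn_small. Qed.

Lemma step_get P p r M o d a : nth IHalt P p = IGet d a -> r a < s -> M (r a) < W ->
  step w s P (Config p r M o) = Some (Config p.+1 [eta r with d |-> M (r a)] M o).
Proof. by rewrite /step /fetch /= => -> -> h; rewrite /set_reg modn_small. Qed.

Definition bounded (f : nat -> nat) := forall i, f i < W.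

Lemma bounded_with f d x : bounded f -> x < W -> bounded [eta f with d |-> x].
Proof. by move=> hf hx i /=; case: eqP. Qed.

Definition keeps (d : nat) (r r' : nat -> nat) := forall i, i < d -> r' i = r i.

Lemma idx_ok P p r M o a d : code_at P p (idx a d) -> 0 < d -> r 0 = n ->
  bounded r -> a < K -> r d < n -> r d.+1 < n ->
  exists r', [/\ runs P 7 (Config p r M o) (Config (p + 7) r' M o),
    r' d = addr a (r d) (r d.+1), keeps d r r' & bounded r'].
Proof.
move=> /code_at_cons[i1 /code_at_cons[i2 /code_at_cons[i3 /code_at_cons[i4]]]].
move=> /code_at_cons[i5 /code_at_cons[i6 /code_at_cons[i7 _]]] d0 r0 br ha hi hj.
have lt := addr_lt ha hi hj; have := lt; rewrite /addr => lt'.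
have E1 : (d.+1 == d) = false by lia.
have E2 : (d.+2 == d) = false by lia.
have E3 : (d.+2 == d.+1) = false by lia.
have E4 : (d == d.+1) = false by lia.
have E5 : (d == d.+2) = false by lia.
have E6 : (d.+1 == d.+2) = false by lia.
have E7 : (0 == d) = false by lia.
(* Every intermediate value is at most the final address, so nothing wraps around. *)
have an : a * n < W by nia.
have a1 : a * n + r d < W by nia.
have a2 : (a * n + r d) * n < W by lia.
have W1 : 1 < W by lia.
eexists; split.
- rewrite addnC; do 7 rewrite addSn; rewrite add0n.
  do ![apply: runsS; first (by apply: step_const; [eassumption|nia]) ||
       (by apply: step_mul; [eassumption|rewrite /= ?eqxx ?E1 ?E2 ?E3 ?E4 ?E5 ?E6 ?E7 /= r0; nia]) ||
       (by apply: step_add; [eassumption|rewrite /= ?eqxx ?E1 ?E2 ?E3 ?E4 ?E5 ?E6 ?E7 /= ?r0; nia])].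
  exact: runs0.
- rewrite /= ?eqxx ?E1 ?E2 ?E3 ?E4 ?E5 ?E6 ?E7 /= r0 /addr; nia.
- by move=> i hi' /=; do ![case: eqP => ?; first lia].
- do ![apply: bounded_with => //]; rewrite /= ?eqxx ?E1 ?E2 ?E3 ?E4 ?E5 ?E6 ?E7 /= ?r0; nia.
Qed.

(** The simulation relation: variables sit in the lowest registers, and memory agrees with the
    matrices on indices in range. *)
Definition rel (env : seq nat) (m : arrays) (r M : nat -> nat) : Prop :=
  [/\ forall i, i < size env -> r i = nth 0 env i,
      forall a i j, a < K -> i < n -> j < n -> M (addr a i j) = m a i j,
      bounded r & bounded M].

Lemma rel_keeps env m r M r' d : size env <= d -> keeps d r r' -> bounded r' ->
  rel env m r M -> rel env m r' M.
Proof. by move=> hd k b [h1 h2 h3 h4]; split=> // i hi; rewrite k ?h1 //; lia. Qed.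

Definition wf_env (env : seq nat) := 0 < size env /\ nth 0 env 0 = n.

(** Induction on the expression. The second operand is compiled for register [d.+1] and keeps
    everything below, so the value of the first one survives in [d]. *)
Lemma cexpr_ok P e d p r M o env m :
  code_at P p (cexpr e d) -> rel env m r M -> wf_env env -> size env <= d ->
  safe W K n env m e ->
  exists r', [/\ runs P (size (cexpr e d)) (Config p r M o)
                   (Config (p + size (cexpr e d)) r' M o),
    r' d = eval env m e, keeps d r r' & bounded r'].
Proof.
elim: e d p r => [i|k|e1 IH1 e2 IH2|e1 IH1 e2 IH2|a e1 IH1 e2 IH2] d p r.
- move=> /code_at_cons[i1 /code_at_cons[i2 _]] [h1 h2 h3 h4] we hd /= si.
  have id : (i == d) = false by lia.
  eexists; split.
  + rewrite addn2; apply: runsS; first by apply: (step_const _ _ _ i1); lia.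
    apply: runsS; last exact: runs0.
    by apply: (step_add _ _ i2); rewrite /= eqxx id add0n.
  + by rewrite /= eqxx id h1.
  + by move=> j hj /=; case: eqP => //; lia.
  + by do ![apply: bounded_with => //]; rewrite /= ?eqxx ?id ?add0n //; lia.
- move=> /code_at_cons[i1 _] [h1 h2 h3 h4] we hd /= sk; eexists; split.
  + by rewrite addn1; apply: runsS; [exact: (step_const _ _ _ i1)|exact: runs0].
  + by rewrite /= eqxx.
  + by move=> j hj /=; case: eqP => //; lia.
  + exact: bounded_with.
- rewrite /= => /code_at_cat[c1 /code_at_cat[c2 /code_at_cons[i3 _]]] R we hd.
  move=> /and3P[s1 s2 s3].
  have [r1 [x1 v1 k1 b1]] := IH1 _ _ _ c1 R we hd s1.
  have R1 := rel_keeps hd k1 b1 R.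
  have [r2 [x2 v2 k2 b2]] := IH2 _ _ _ c2 R1 we (leqW hd) s2.
  have vv : r2 d = eval env m e1 by rewrite k2.
  exists [eta r2 with d |-> r2 d + r2 d.+1]; split.
  + rewrite !size_cat !addnA; apply: runs_trans; first exact: runs_trans x1 x2.
    rewrite /= addn1; apply: runsS; last exact: runs0.
    by apply: (step_add _ _ i3); rewrite vv v2.
  + by rewrite /= eqxx vv v2.
  + by move=> j hj /=; case: eqP => [|_]; [lia|rewrite k2 ?k1 //; lia].
  + by apply: bounded_with; rewrite ?vv ?v2.
- rewrite /= => /code_at_cat[c1 /code_at_cat[c2 /code_at_cons[i3 _]]] R we hd.
  move=> /andP[s1 s2].
  have [r1 [x1 v1 k1 b1]] := IH1 _ _ _ c1 R we hd s1.
  have R1 := rel_keeps hd k1 b1 R.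
  have [r2 [x2 v2 k2 b2]] := IH2 _ _ _ c2 R1 we (leqW hd) s2.
  have vv : r2 d = eval env m e1 by rewrite k2.
  exists [eta r2 with d |-> r2 d - r2 d.+1]; split.
  + rewrite !size_cat !addnA; apply: runs_trans; first exact: runs_trans x1 x2.
    rewrite /= addn1; apply: runsS; last exact: runs0.
    exact: (step_sub _ _ i3).
  + by rewrite /= eqxx vv v2.
  + by move=> j hj /=; case: eqP => [|_]; [lia|rewrite k2 ?k1 //; lia].
  + by apply: bounded_with => //; have := b2 d; lia.
- have -> : size (cexpr (Get a e1 e2) d) = size (cexpr e1 d) + size (cexpr e2 d.+1) + 7 + 1.
    by rewrite /= !size_cat /=; lia.
  move=> /code_at_cat[c1 /code_at_cat[c2 /code_at_cat[c3 /code_at_cons[i4 _]]]].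
  move=> R we hd /= /and5P[s1 s2 ha hi hj].
  have [r1 [x1 v1 k1 b1]] := IH1 _ _ _ c1 R we hd s1.
  have R1 := rel_keeps hd k1 b1 R.
  have [r2 [x2 v2 k2 b2]] := IH2 _ _ _ c2 R1 we (leqW hd) s2.
  have vv : r2 d = eval env m e1 by rewrite k2.
  have [h1 h2 h3 h4] := R; have [we1 we2] := we.
  have r20 : r2 0 = n by rewrite k2 ?k1 ?h1 ?we2 //; lia.
  rewrite -vv -v2 in hi hj *.
  have [r3 [x3 v3 k3 b3]] := idx_ok M o c3 (leq_trans we1 hd) r20 b2 ha hi hj.
  have lt := addr_lt ha hi hj.
  exists [eta r3 with d |-> M (r3 d)]; split.
  + rewrite !addnA; apply: runs_trans.
      exact: runs_trans (runs_trans x1 x2) x3.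
    rewrite /= addn1; apply: runsS; last exact: runs0.
    by apply: (step_get _ i4); rewrite ?v3.
  + by rewrite /= eqxx v3 h2.
  + by move=> j hj' /=; case: eqP => [|_]; [lia|rewrite k3 ?k2 ?k1 //; lia].
  + exact: bounded_with.
Qed.

Lemma rel_rcons env m r M x : rel env m r M -> r (size env) = x ->
  rel (rcons env x) m r M.
Proof.
case=> h1 h2 h3 h4 hx; split=> // i; rewrite size_rcons nth_rcons ltnS leq_eqVlt.
by case: ltnP => [hi _|_]; [exact: h1|case: eqP => // ->].
Qed.

Lemma wf_rcons env x : wf_env env -> wf_env (rcons env x).
Proof. by case=> h1 h2; split; rewrite ?size_rcons // nth_rcons h1. Qed.

Lemma rel_belast env m r M x : rel (rcons env x) m r M -> rel env m r M.
Proof.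
case=> h1 h2 h3 h4; split=> // i hi.
by rewrite h1 ?size_rcons ?nth_rcons ?hi // ltnW.
Qed.

(** The simulation theorem, by induction on the command: a [wp] fact becomes a machine run of
    bounded length that ends in a state related to one satisfying [Q]. *)
Lemma code_ok P c p env Q m r M o :
  code_at P p (code p c (size env)) -> wf_env env -> rel env m r M ->
  wp W K n c env Q m o ->
  exists k r' M' m' o',
    [/\ k <= cost n c (size env),
        runs P k (Config p r M o) (Config (p + size (code p c (size env))) r' M' o'),
        rel env m' r' M' & Q m' o'].
Proof.
elim: c p env Q m r M o =>
  [|a e1 e2 e3|c1 IH1 c2 IH2|e1 e2 c1 IH1 c2 IH2|c1 IH|e c1 IH|e] p env Q m r M o.
- move=> _ _ R /= q; exists 0, r, M, m, o; split=> //.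
  by rewrite addn0.
- have -> : size (code p (Store a e1 e2 e3) (size env)) = size (cexpr e1 (size env))
      + size (cexpr e2 (size env).+1) + 7 + size (cexpr e3 (size env).+1) + 1.
    by rewrite /= !size_cat /= size_cat /=; lia.
  move=> /code_at_cat[k1 /code_at_cat[k2 /code_at_cat[k3 /code_at_cat[k4 /code_at_cons[i5 _]]]]].
  move=> we R /= [/andP[/and5P[s1 s2 ha hi hj] s3] q].
  set d := size env in k1 k2 k3 k4 i5 *.
  have [r1 [x1 v1 kp1 b1]] := cexpr_ok o k1 R we (leqnn _) s1.
  have R1 := rel_keeps (leqnn _) kp1 b1 R.
  have [r2 [x2 v2 kp2 b2]] := cexpr_ok o k2 R1 we (leqnSn _) s2.
  have vv : r2 d = eval env m e1 by rewrite kp2.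
  have [h1 h2 h3 h4] := R; have [we1 we2] := we.
  have r20 : r2 0 = n by rewrite kp2 ?kp1 ?h1 ?we2 //; lia.
  rewrite -vv -v2 in hi hj q *.
  have [r3 [x3 v3 kp3 b3]] := idx_ok M o k3 we1 r20 b2 ha hi hj.
  have kk : keeps d r r3 by move=> i ii; rewrite kp3 ?kp2 ?kp1 //; lia.
  have R3 := rel_keeps (leqnn _) kk b3 R.
  have [r4 [x4 v4 kp4 b4]] := cexpr_ok o k4 R3 we (leqnSn _) s3.
  have lt := addr_lt ha hi hj.
  have r4d : r4 d = addr a (r2 d) (r2 d.+1) by rewrite kp4 // v3.
  exists (size (cexpr e1 d) + size (cexpr e2 d.+1) + 7 + size (cexpr e3 d.+1) + 1), r4.
  exists [eta M with r4 d |-> r4 d.+1]. 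
  eexists; exists o; split; last exact: q.
  + by rewrite /=; lia.
  + rewrite !addnA; apply: runs_trans.
      exact: runs_trans (runs_trans (runs_trans x1 x2) x3) x4.
    by rewrite /runs /= /step /fetch /= i5 r4d lt addn1.
  + have [g1 g2 g3 g4] := rel_keeps (leqnn _) (fun i hi => kp4 i (leqW hi)) b4 R3.
    split=> //; last exact: bounded_with.
    move=> a' i' j' ha' hi' hj' /=.
    by rewrite r4d addr_inj // /upd v4; case: ifP => // _; apply: g2.
- move=> /code_at_cat[k1 k2] we R /= q.
  have [t1 [r1 [M1 [m1 [o1 [le1 x1 R1 q1]]]]]] := IH1 _ _ _ _ _ _ _ k1 we R q.
  have [t2 [r2 [M2 [m2 [o2 [le2 x2 R2 q2]]]]]] := IH2 _ _ _ _ _ _ _ k2 we R1 q1.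
  exists (t1 + t2), r2, M2, m2, o2; split=> //; first exact: leq_add.
  by rewrite size_cat addnA; exact: runs_trans x1 x2.
- rewrite /= => /code_at_cat[/code_at_cat[k1 k2] /code_at_cons[i3 /code_at_cat[k4 /code_at_cons[i5 k6]]]].
  move=> we R [/andP[s1 s2] q].
  set d := size env in k1 k2 i3 k4 i5 k6 *.
  have [r1 [x1 v1 kp1 b1]] := cexpr_ok o k1 R we (leqnn _) s1.
  have R1 := rel_keeps (leqnn _) kp1 b1 R.
  have [r2 [x2 v2 kp2 b2]] := cexpr_ok o k2 R1 we (leqnSn _) s2.
  have vv : r2 d = eval env m e1 by rewrite kp2.
  have R2 := rel_keeps (leqnn _) (fun i hi => kp2 i (leqW hi)) b2 R1.
  have x12 := runs_trans x1 x2.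
  move: i3 k4 i5 k6; rewrite size_cat !addnA.
  set p2 := (p + _ + _); set kc2 := code _ c2 d; set kc1 := code _ c1 d.
  move=> i3 k4 i5 k6.
  (* The code of [c1] comes last and runs into the end of the block; the code of [c2] precedes it
     and ends with a jump over it. *)
  move: q; case: ifP => lt q.
    have [t1 [r3 [M1 [m1 [o1 [le1 x3 R3 q1]]]]]] := IH1 _ _ _ _ _ _ _ k6 we R2 q.
    exists (size (cexpr e1 d) + size (cexpr e2 d.+1) + t1.+1), r3, M1, m1, o1.
    split=> //=; first by rewrite -/d in le1; lia.
    apply: runs_trans; first exact: x12.
    apply: runsS; first by rewrite /step /fetch /= i3 vv v2 lt.
    move: x3; congr runs; congr Config; rewrite !size_cat /= size_cat /= -/d -/kc2 -/kc1 /p2; lia.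
  have [t1 [r3 [M1 [m1 [o1 [le1 x3 R3 q1]]]]]] := IH2 _ _ _ _ _ _ _ k4 we R2 q.
  exists (size (cexpr e1 d) + size (cexpr e2 d.+1) + (t1 + 1).+1), r3, M1, m1, o1.
  split=> //=; first by rewrite -/d in le1; lia.
  apply: runs_trans; first exact: x12.
  apply: runsS; first by rewrite /step /fetch /= i3 vv v2 lt.
  apply: runs_trans; first exact: x3.
  apply: runsS; first by rewrite /step /fetch /= i5.
  rewrite /runs /=; congr (Some (Config _ _ _ _)).
  rewrite !size_cat /= size_cat /= -/d -/kc2 -/kc1 /p2; lia.
- rewrite /= => /code_at_cons[i1 /code_at_cons[i2 /code_at_cons[i3 /code_at_cat[k4 kr]]]].
  have /code_at_cons[i5 /code_at_cons[i6 /code_at_cons[i7 _]]] := kr.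
  move=> we R [I [I0 IS In]].
  set d := size env in i1 i2 i3 k4 i5 i6 i7 *.
  set kc := code _ c1 _ in i3 k4 i5 i6 i7 *.
  have [we1 we2] := we.
  have W1 : 1 < W by lia.
  (* The state each time control reaches the loop test at [p.+1], with [j] in register [d]; the
     summand 1 is the initialization of the counter. *)
  have loop : forall j, j <= n -> exists k r' M' m' o',
      [/\ k <= j * (cost n c1 d.+1 + 4) + 1,
       runs P k (Config p r M o) (Config p.+1 r' M' o'),
       rel (rcons env j) m' r' M' & I j m' o'].
    elim=> [_|j IHj jn].
      exists 1, [eta r with d |-> 0], M, m, o; split=> //.
        by apply: runsS; [apply: (step_const _ _ _ i1); lia|exact: runs0].
      apply: rel_rcons; last by rewrite /= eqxx.
      apply: (@rel_keeps env m r M _ d) => //.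
        by move=> i hi /=; case: eqP => //; lia.
      by case: R => _ _ b _; apply: bounded_with => //; lia.
    have [t1 [r1 [M1 [m1 [o1 [le1 x1 R1 q1]]]]]] := IHj (ltnW jn).
    have q2 := IS _ _ _ jn q1.
    have k4' : code_at P p.+3 (code p.+3 c1 (size (rcons env j))) by rewrite size_rcons.
    have [t2 [r2 [M2 [m2 [o2 [le2 x2 R2 q3]]]]]] := IH _ _ _ _ _ _ o1 k4' (wf_rcons _ we) R1 q2.
    move: le2 x2; rewrite !size_rcons -/d -/kc => le2 x2.
    have [g1 g2 g3 g4] := R1; have [h1 h2 h3 h4] := R2.
    have r1d : r1 d = j by rewrite g1 ?size_rcons // nth_rcons ltnn eqxx.
    have r10 : r1 0 = n by rewrite g1 ?size_rcons // nth_rcons we1.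
    have r2d : r2 d = j by rewrite h1 ?size_rcons // nth_rcons ltnn eqxx.
    have dd : (d == d.+1) = false by lia.
    pose r3 := [eta r2 with d.+1 |-> 1].
    have r3d : r3 d = j by rewrite /= dd.
    have r3d1 : r3 d.+1 = 1 by rewrite /= eqxx.
    exists (t1 + (1 + (t2 + 3))), [eta r3 with d |-> r3 d + r3 d.+1], M2, m2, o2.
    split=> //; first lia.
    + apply: runs_trans; first exact: x1.
      rewrite add1n; apply: runsS; first by rewrite /step /fetch /= i2 r1d r10 jn.
      apply: runs_trans; first exact: x2.
      apply: runsS; first by apply: step_const; eassumption.
      rewrite -/r3; apply: runsS; first by apply: step_add; [eassumption|rewrite r3d r3d1; lia].
      by apply: runsS; first by rewrite /step /fetch /= i7.
    + rewrite r3d r3d1 addn1; apply: rel_rcons; last by rewrite /= eqxx.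
      apply: (@rel_keeps env m2 r2 M2 _ d) => //; last by exact: rel_belast R2.
        by move=> i hi /=; case: eqP => [|_]; [lia|case: eqP => //; lia].
      by do ![apply: bounded_with => //]; lia.
  have [t1 [r1 [M1 [m1 [o1 [le1 x1 R1 q1]]]]]] := loop n (leqnn _).
  have [g1 g2 g3 g4] := R1.
  have r1d : r1 d = n by rewrite g1 ?size_rcons // nth_rcons ltnn eqxx.
  have r10 : r1 0 = n by rewrite g1 ?size_rcons // nth_rcons we1.
  exists (t1 + 2), r1, M1, m1, o1; split=> //; first by lia.
  + apply: runs_trans; first exact: x1.
    apply: runsS; first by rewrite /step /fetch /= i2 r1d r10 ltnn.
    apply: runsS; first by rewrite /step /fetch /= i3.
    rewrite /runs /=; congr (Some (Config _ _ _ _)); rewrite size_cat /=; lia.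
  + exact: rel_belast R1.
  + exact: In.
- rewrite /= => /code_at_cat[k1 k2] we R [sf q].
  have [r1 [x1 v1 kp1 b1]] := cexpr_ok o k1 R we (leqnn _) sf.
  have R1 := rel_rcons (rel_keeps (leqnn _) kp1 b1 R) v1.
  move: k2; rewrite -(size_rcons env (eval env m e)) => k2.
  have [t2 [r2 [M2 [m2 [o2 [le2 x2 R2 q2]]]]]] := IH _ _ _ _ _ _ _ k2 (wf_rcons _ we) R1 q.
  exists (size (cexpr e (size env)) + t2), r2, M2, m2, o2; split=> //.
  + by rewrite leq_add2l.
  + by rewrite size_cat addnA; exact: runs_trans x1 x2.
  + exact: rel_belast R2.
- rewrite /= => /code_at_cat[k1 /code_at_cons[i2 _]] we R [sf q].
  have [r1 [x1 v1 kp1 b1]] := cexpr_ok o k1 R we (leqnn _) sf.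
  exists (size (cexpr e (size env)) + 1), r1, M, m, (rcons o (eval env m e)).
  split=> //; last exact: rel_keeps (leqnn _) kp1 b1 R.
  rewrite size_cat addnA; apply: runs_trans; first exact: x1.
  by rewrite /runs /= /step /fetch /= i2 v1 addn1.
Qed.

End Simulation.

(** The two leading instructions load n from cell 0 into register 0, which is the environment
    [[:: n]] that [code] expects for [d = 1]. *)
Definition compile (c : cmd) : program := [:: IConst 1 0; IGet 0 1] ++ code 2 c 1.

Definition space (K n : nat) : nat := 1 + K * n * n.

Lemma compile_ok w K n c x Q :
  space K n < 2 ^ w -> n < 2 ^ w -> size x <= space K n ->
  (forall i, nth 0 x i < 2 ^ w) -> nth 0 x 0 = n ->
  wp (2 ^ w) K n c [:: n] Q (fun a i j => nth 0 x (addr n a i j)) [::] ->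
  exists2 y, runs_within w (cost n c 1 + 2) (space K n) (compile c) x y
           & exists m, Q m y.
Proof.
move=> sW nW sx xW x0 q.
have at0 : code_at (compile c) 0 (IConst 1 0 :: IGet 0 1 :: code 2 c 1) by move=> i; rewrite add0n.
have /code_at_cons[i1 /code_at_cons[i2 kc]] := at0.
pose r1 := [eta (fun=> 0) with 1 |-> 0] : nat -> nat.
pose r2 := [eta r1 with 0 |-> n] : nat -> nat.
have W0 : 0 < 2 ^ w by lia.
have R : rel w K n [:: n] (fun a i j => nth 0 x (addr n a i j)) r2 (nth 0 x).
  split=> //; first by case.
  by do 2![apply: bounded_with => //].
have x1 : runs w (space K n) (compile c) 2 (init x) (Config 2 r2 (nth 0 x) [::]).
  apply: runsS; first by apply: step_const; eassumption.
  apply: runsS; last exact: runs0.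
  by rewrite (step_get _ i2) //= x0.
have [k [r [M [m [y [le xk _ qm]]]]]] :=
  @code_ok w (space K n) K n erefl sW nW _ _ _ [:: n] _ _ _ _ _ kc (conj isT erefl) R q.
exists y; last by exists m.
split=> //; exists (2 + k); eexists; split; [|exact: runs_trans x1 xk| |] => //.
  by rewrite addnC leq_add2r.
(* Control has run off the end of the program, where [nth] yields its default [IHalt]. *)
by rewrite /fetch nth_default //= size_cat.
Qed.

(** * Realizations *)

(** Strict temporal walks: vertices may repeat, and growth is at the far end, which suits arguments
    about the last edge. Least arrival times are the same as for paths. *)
Inductive walk n (G : temporal_graph n) (x : 'I_n) : 'I_n -> nat -> Prop :=
| walk0 : walk G x x 0
| walkS w v t t' : walk G x w t -> t < t' ->
    [set w; v] \in edges (underlying G) -> t' \in label G [set w; v] ->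
    walk G x v t'.

Lemma sorted_rcons_ltn (ts : seq nat) t : 0 < t ->
  sorted ltn (rcons ts t) = sorted ltn ts && (last 0 ts < t).
Proof. by case: ts => [|a ts] //= t0; rewrite ?t0 // rcons_path. Qed.

(** Splits off the last edge. Positivity of labels makes [arrival_time p < a.2] correct also for
    empty [p], whose arrival time is the default 0. *)
Lemma strict_path_rcons n (G : temporal_graph n) u v p (a : 'I_n * nat) :
  let l := last u (unzip1 p) in
  strict_temporal_path G u v (rcons p a) <->
  [/\ strict_temporal_path G u l p, a.1 = v, v \notin u :: unzip1 p,
      arrival_time p < a.2 & [set l; v] \in edges (underlying G) /\
        a.2 \in label G [set l; v]].
Proof.
rewrite /strict_temporal_path /arrival_time /unzip1 /unzip2 !map_rcons /=.
rewrite -rcons_cons; set vs := u :: _; set ts := map snd p.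
have sv : size vs = (size p).+1 by rewrite /= size_map.
have st : size ts = size p by rewrite size_map.
have s1 : size (map fst p) = size p by rewrite size_map.
have ll : nth u vs (size p) = last u (map fst p).
  by rewrite -[size p]/((size p).+1.-1) -sv nth_last.
split.
- case=> U L S E; have La : a.1 = v by move: L; rewrite last_rcons.
  have [] := E (size p); first by rewrite size_rcons.
  rewrite !nth_rcons sv s1 st ltnSn !ltnn !eqxx ll La => E1 E2.
  have a0 := label_pos E1 E2.
  have : uniq (rcons vs a.1) by [].
  rewrite rcons_uniq La => /andP[nv U'].
  move: S; rewrite sorted_rcons_ltn // => /andP[S lt].
  split=> //; split=> // i ip.
  have := E i; rewrite size_rcons ltnS ltnW // => /(_ isT).
  by rewrite !nth_rcons sv st s1 ltnS ltnW // ip.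
- case=> -[U L S E] La nv lt [E1 E2]; have a0 := label_pos E1 E2; split.
  + suff : uniq (rcons vs a.1) by [].
    by rewrite rcons_uniq La nv.
  + by rewrite last_rcons.
  + by rewrite sorted_rcons_ltn // S.
  + move=> i; rewrite size_rcons ltnS leq_eqVlt => /orP[/eqP->|ip].
      by rewrite !nth_rcons sv s1 st ltnSn !ltnn !eqxx ll La.
    by rewrite !nth_rcons sv st s1 ltnS ltnW // ip; apply: E.
Qed.

Lemma arrival_rcons n (p : seq ('I_n * nat)) a : arrival_time (rcons p a) = a.2.
Proof. by rewrite /arrival_time /unzip2 map_rcons last_rcons. Qed.

Lemma strict_path_walk n (G : temporal_graph n) u v p :
  strict_temporal_path G u v p -> walk G u v (arrival_time p).
Proof.
elim/last_ind: p v => [|p a IH] v; first by case=> _ /= <- _ _; exact: walk0.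
rewrite arrival_rcons => /strict_path_rcons[/IH P La nv lt [E1 E2]].
exact: walkS P lt E1 E2.
Qed.

(** Cut the path at [v]: times increase along it, so the prefix arrives no later. This removes
    repeated vertices from walks. *)
Lemma strict_path_truncate n (G : temporal_graph n) u w v p :
  strict_temporal_path G u w p -> v \in u :: unzip1 p ->
  exists2 p', strict_temporal_path G u v p' & arrival_time p' <= arrival_time p.
Proof.
elim/last_ind: p w => [|p a IH] w.
  by move=> _; rewrite inE => /eqP->; exists [::].
move=> Pa; have /strict_path_rcons[P La nv lt E] := Pa.
rewrite /unzip1 map_rcons -rcons_cons mem_rcons inE => /orP[/eqP->|/(IH _ P)[p' P' le]].
  by rewrite La; exists (rcons p a).
by exists p' => //; rewrite arrival_rcons (leq_trans le) // ltnW.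
Qed.

(** Induction on the walk: if the new vertex was visited before, truncate the path there, otherwise
    append the edge. *)
Lemma walk_strict_path n (G : temporal_graph n) u v t : walk G u v t ->
  exists2 p, strict_temporal_path G u v p & arrival_time p <= t.
Proof.
elim=> [|w {}v {}t t' _ [p P le] lt E1 E2]; first by exists [::].
have lt' := leq_ltn_trans le lt.
have [vp|vp] := boolP (v \in u :: unzip1 p).
  have [p' P' le'] := strict_path_truncate P vp.
  by exists p' => //; rewrite (leq_trans le') // ltnW.
have lw : last u (unzip1 p) = w by case: P.
exists (rcons p (v, t')); last by rewrite arrival_rcons.
by apply/strict_path_rcons; split=> //; rewrite lw.
Qed.

Lemma min_timeP (A : nat -> Prop) :
  match min_time A with
  | Some t => A t /\ forall t', A t' -> t <= t'
  | None => forall t, ~ A t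
  end.
Proof.
rewrite /min_time; case: pselect => [h|h].
  case: ex_minnP => t /asboolP At min; split=> // t' At'.
  by apply: min; apply/asboolP.
by move=> t At; apply: h; exists t; apply/asboolP.
Qed.

(** Walks and strict temporal paths have the same least arrival times, and [walk0] accounts for the
    zero diagonal. *)
Lemma FoP n (G : temporal_graph n) u v :
  match Fo G u v with
  | Some t => walk G u v t /\ forall t', walk G u v t' -> t <= t'
  | None => forall t, ~ walk G u v t
  end.
Proof.
rewrite mxE; case: eqP => [->|_]; first by split=> //; exact: walk0.
have := min_timeP (arrives_at G u v); case: min_time => [t [[p P <-] min]|no].
  split=> [|t' /walk_strict_path[p' P' le]]; first exact: strict_path_walk.
  by apply: leq_trans le; apply: min; exists p'.
by move=> t /walk_strict_path[p P _]; apply: (no (arrival_time p)); exists p.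
Qed.

(** * Admissible labels and the realizability criterion *)

Section Realization.

Variables (x : instance) (B : nat).
Local Notation n := (inst_n x).
Local Notation D := (inst_D x).

(* Times are shifted by one, and [B] stands for infinity. *)
Definition key (u v : 'I_n) : nat := oapp S B (D u v).

Hypothesis B_gt : forall u v k, D u v = Some k -> k.+1 < B.

(** [w] may precede [v] on a foremost path from [u]: it is reached earlier, and [D u v] is
    admissible for the edge [vw], since whoever is at one end before that time is at the other end
    by that time. *)
Definition good (u v w : 'I_n) : Prop :=
  [/\ [set v; w] \in edges (inst_Gp x), key u w < key u v, key u v < B &
    forall y, (key y v < key u v -> key y w <= key u v) /\
              (key y w < key u v -> key y v <= key u v)].

Lemma key_lt u v k : (key u v < k.+1) -> k.+1 <= B -> exists2 t, D u v = Some t & t < k.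
Proof. by rewrite /key; case: (D u v) => [t|] /=; [exists t|lia]. Qed.

(** Let [w] be the last vertex before [v] on a foremost walk. The final edge carries the label
    [D u v], so every walk that reaches one of its ends earlier extends across it, which is
    admissibility. *)
Lemma realization_good (G : temporal_graph n) u v : realization G ->
  u != v -> D u v != None -> exists w, good u v w.
Proof.
case=> FoD /subsetP sub uv; case Duv: (D u v) => [t|] // _.
have := FoP G u v; rewrite FoD Duv => -[P min].
case: P uv Duv min => [|w {}v t1 {}t P lt E1 E2]; first by rewrite eqxx.
move=> uv Duv min; have tB := B_gt Duv; exists w.
have le y z k : walk G y z k -> key y z <= k.+1.
  by have := FoP G y z; rewrite FoD /key; case: (D y z) => [k' [_ h] /h|h /h].
have kuv : key u v = t.+1 by rewrite /key Duv.
rewrite /good kuv; split=> //; first by rewrite setUC sub.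
  exact: leq_ltn_trans (le _ _ _ P) _.
move=> y; split=> /key_lt/(_ (ltnW tB))[k Dk kt]; apply: le.
  have := FoP G y v; rewrite FoD Dk => -[Q _].
  by apply: walkS Q kt _ _; rewrite setUC.
by have := FoP G y w; rewrite FoD Dk => -[Q _]; apply: walkS Q kt _ _.
Qed.

(** * The temporal graph defined by a choice of predecessors *)

Variable par : 'I_n -> 'I_n -> option 'I_n.
Hypothesis par_good : forall u v w, par u v = Some w -> good u v w.

Definition par_edge (p : 'I_n * 'I_n) : {set 'I_n} :=
  if par p.1 p.2 is Some w then [set w; p.2] else set0.

Definition par_edges : {set {set 'I_n}} :=
  [set par_edge p | p in [pred p | par p.1 p.2]].

Definition par_pairs (e : {set 'I_n}) : seq ('I_n * 'I_n) :=
  enum [pred p | par p.1 p.2 & par_edge p == e].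

(** By [par_good] the pairs with a chosen predecessor have finite distance, so the default 0 is
    never taken. *)
Definition par_label (e : {set 'I_n}) : {fset nat} :=
  seq_fset tt [seq odflt 0 (D p.1 p.2) | p <- par_pairs e].

Lemma par_labelP e t : reflect
  (exists u v w, [/\ par u v = Some w, D u v = Some t & e = [set w; v]])
  ((e \in par_edges) && (t \in par_label e)).
Proof.
apply: (iffP andP).
  case=> _; rewrite seq_fsetE => /mapP[[u v]]; rewrite mem_enum inE /par_edge /=.
  case Ep: (par u v) => [w|] //= /eqP Ee Et; exists u, v, w; split=> //.
  have [_ _ + _] := par_good Ep; rewrite /key Et; case: (D u v) => //=.
  by rewrite ltnn.
case=> u [v [w [Ep Ed Ee]]]; split.
  by apply/imsetP; exists (u, v); rewrite ?inE /par_edge /= Ep.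
rewrite seq_fsetE; apply/mapP; exists (u, v); last by rewrite /= Ed.
by rewrite mem_enum inE /par_edge /= Ep Ee /=.
Qed.

Lemma par_edges_sub : par_edges \subset edges (inst_Gp x).
Proof.
apply/subsetP=> e /imsetP[[u v]]; rewrite inE /par_edge /=.
by case Ep: (par u v) => [w|] // _ ->; have [+ _ _ _] := par_good Ep; rewrite setUC.
Qed.

Lemma par_edges_card2 e : e \in par_edges -> #|e| = 2.
Proof. by move/(subsetP par_edges_sub); apply: edges_card2. Qed.

Definition par_graph := Graph par_edges_card2.

Lemma key_gt0 u v : key u v < B -> 0 < key u v.
Proof. by rewrite /key; case: (D u v) => //=; rewrite ltnn. Qed.

(** The predecessor has a smaller key, and finite keys are at least 1, so the key of the label is at
    least 2. *)
Lemma par_label_pos e t : e \in edges par_graph -> t \in par_label e -> 0 < t.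
Proof.
move=> /= E1 E2; have /par_labelP[u [v [w [Ep Ed _]]]] : (e \in par_edges) && (t \in par_label e).
  by rewrite E1.
have [_ + + _] := par_good Ep; rewrite /(key u v) Ed /= => lt tB.
by have := @key_gt0 u w; lia.
Qed.

Definition par_tgraph := TemporalGraph par_label_pos.

(** Charge each label of an edge to a pair that produces it. Every pair belongs to a single edge,
    and there are [n ^ 2] pairs. *)
Lemma par_num_labels : num_labels par_tgraph <= n ^ 2.
Proof.
rewrite /num_labels.
apply: (@leq_trans (\sum_(e in par_edges) \sum_(p | par p.1 p.2 && (par_edge p == e)) 1)).
  apply: leq_sum => e _; rewrite -[label _ _]/(seq_fset _ _) size_seq_fset sum1_card.
  by rewrite (leq_trans (size_undup _)) // size_map -cardE.
rewrite -(partition_big par_edge (mem par_edges)) /=.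
  by rewrite sum1_card (leq_trans (max_card _)) // card_prod card_ord mulnn.
by move=> p hp; apply/imsetP; exists p.
Qed.

Lemma par_edge_labelled e : e \in edges (underlying par_tgraph) ->
  label par_tgraph e <> fset0.
Proof.
move=> /= /imsetP[[u v]]; rewrite inE /par_edge /=; case Ep: (par u v) => [w|] // _ Ee L.
have [_ _ + _] := par_good Ep; case Ed: (D u v) => [t|]; rewrite /key Ed /= ?ltnn // => _.
have /andP[_] : (e \in par_edges) && (t \in par_label e) by apply/par_labelP; exists u, v, w.
by rewrite L inE.
Qed.

Hypothesis par_full : forall u v, u != v -> D u v != None -> par u v.

(** No walk is faster than D. The last label is [D a b] for some pair and is admissible; the walk
    reaches [w] before that time, so admissibility with [y := u] bounds the key of [v]. *)
Lemma par_walk_key u v t : walk par_tgraph u v t -> key u v <= t.+1 < B.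
Proof.
elim=> [|w {}v {}t t' _ /andP[le _] lt E1 E2].
  have /(inst_dist (i := x) u u).2 Ed := erefl u.
  by rewrite /key Ed /=; apply: B_gt Ed.
have /par_labelP[a [b [c [Ep Ed Ee]]]] : ([set w; v] \in par_edges) && (t' \in par_label [set w; v]).
  by rewrite E1.
have kab : key a b = t'.+1 by rewrite /key Ed.
have [_ ltc kB /(_ u)] := par_good Ep; rewrite kab in kB * => -[h1 h2].
rewrite kB andbT; have hw : key u w < t'.+1 by lia.
have wv : w != v by have := par_edges_card2 E1; rewrite cards2; case: eqP.
(* The edge may be traversed in either direction, and the two halves of admissibility treat one
   direction each. *)
have : w \in [set c; b] by rewrite -Ee !inE eqxx.
have : v \in [set c; b] by rewrite -Ee !inE eqxx orbT.
by rewrite !inE => /orP[]/eqP Ev /orP[]/eqP Ew; subst w v; rewrite ?eqxx in wv; auto.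
Qed.

(** Strong induction on the time: the predecessor of [v] is reached earlier, and the chosen edge
    carries exactly the label [t]. *)
Lemma par_key_walk u v t : D u v = Some t -> walk par_tgraph u v t.
Proof.
elim/ltn_ind: t v => t IH v Ed; have [uv|uv] := eqVneq u v.
  move: Ed; rewrite -uv; have /(inst_dist (i := x) u u).2 -> := erefl u.
  by case=> <-; exact: walk0.
have := par_full uv; rewrite Ed => /(_ isT); case Ep: (par u v) => [w|] // _.
have [_ lt lB _] := par_good Ep.
have kuv : key u v = t.+1 by rewrite /key Ed.
have [k Ek kt] : exists2 k, D u w = Some k & k < t.
  by apply: key_lt; rewrite -kuv // ltnW.
have /andP[E1 E2] : ([set w; v] \in par_edges) && (t \in par_label [set w; v]).
  by apply/par_labelP; exists u, v, w.
exact: walkS (IH _ kt _ Ek) kt E1 E2.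
Qed.

Lemma par_realization : realization par_tgraph.
Proof.
split; last exact: par_edges_sub.
apply/matrixP=> u v; have := FoP par_tgraph u v.
have hi t := @par_walk_key u v t; have lo t := @par_key_walk u v t.
case: (Fo _ u v) => [t [P min]|no]; case Ed: (D u v) => [k|] //.
- congr Some; apply/eqP; rewrite eqn_leq (min _ (lo _ Ed)) /=.
  by have := hi _ P; rewrite /key Ed => /andP[].
- by have /andP[h1 h2] := hi _ P; move: (leq_ltn_trans h1 h2); rewrite /key Ed /= ltnn.
- by case: (no k); apply: lo.
Qed.

End Realization.

(** * The algorithm *)

Lemma wp_for2 W K n c env (I : nat -> nat -> arrays -> seq nat -> Prop) Q m o :
  I 0 0 m o ->
  (forall i j m' o', i < n -> j < n -> I i j m' o' ->
    wp W K n c (rcons (rcons env i) j) (I i j.+1) m' o') ->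
  (forall i m' o', i < n -> I i n m' o' -> I i.+1 0 m' o') ->
  (forall m' o', I n 0 m' o' -> Q m' o') ->
  wp W K n (For (For c)) env Q m o.
Proof.
move=> I0 IS In IQ; exists (fun i => I i 0); split=> // i m' o' hi Ii.
exists (fun j => I i j); split=> // [j m1 o1|m1 o1]; first exact: IS.
exact: In.
Qed.

Lemma wp_seq W K n c1 c2 env Q m o :
  wp W K n c1 env (wp W K n c2 env Q) m o -> wp W K n (Seq c1 c2) env Q m o.
Proof. by []. Qed.

Lemma wp_if W K n e1 e2 c1 c2 env Q m o :
  safe W K n env m e1 && safe W K n env m e2 ->
  (eval env m e1 < eval env m e2 -> wp W K n c1 env Q m o) ->
  (eval env m e2 <= eval env m e1 -> wp W K n c2 env Q m o) ->
  wp W K n (If e1 e2 c1 c2) env Q m o.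
Proof. by move=> h h1 h2; split=> //; case: ltnP. Qed.

(** The frame condition: only matrices listed in [l] may have changed. *)
Definition same (l : seq nat) (m m' : arrays) : Prop :=
  forall a i j, a \notin l -> m' a i j = m a i j.

Lemma same_trans l m1 m2 m3 : same l m1 m2 -> same l m2 m3 -> same l m1 m3.
Proof. by move=> h1 h2 a i j al; rewrite h2 // h1. Qed.

Lemma same_sub l l' m m' : {subset l <= l'} -> same l m m' -> same l' m m'.
Proof. by move=> sub h a i j al; rewrite h //; apply: contra al; apply: sub. Qed.

Lemma same_upd l m m' a i j x : a \in l -> same l m m' -> same l m (upd m' a i j x).
Proof.
move=> al h a' i' j' al'; rewrite /upd; case: eqP => [E|_]; last exact: h.
by rewrite E al in al'.
Qed.

Lemma updE m a i j x i' j' :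
  upd m a i j x a i' j' = if (i' == i) && (j' == j) then x else m a i' j'.
Proof. by rewrite /upd eqxx. Qed.

Lemma upd_neq m a i j x a' i' j' : a' != a -> upd m a i j x a' i' j' = m a' i' j'.
Proof. by rewrite /upd => /negPf->. Qed.

(** The pairs [(u, v)] already processed when a double loop enters round [(i, j)]. *)
Definition lex (i j u v : nat) : bool := (u < i) || (u == i) && (v < j).

Lemma lex00 u v : lex 0 0 u v = false.
Proof. by rewrite /lex !ltn0 andbF. Qed.

(** The bound [k] lets the same formula describe the partial count after [k] rounds of the counting
    loop. *)
Definition rank (f : nat -> nat) (k x : nat) : nat := \sum_(y < k) (f y < f x).

Lemma rankS f k x : rank f k.+1 x = rank f k x + (f k < f x).
Proof. by rewrite /rank big_ord_recr. Qed.

Lemma rank_le f k x : rank f k x <= k.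
Proof.
elim: k => [|k IH]; first by rewrite /rank big_ord0.
by rewrite rankS; case: (_ < _); lia.
Qed.

Lemma rank_mono f k x y : f y <= f x -> rank f k y <= rank f k x.
Proof. by move=> h; apply: leq_sum => z _; case: ltnP => // hz; rewrite (leq_trans hz). Qed.

Lemma rank_smono f k x y : y < k -> f y < f x -> rank f k y < rank f k x.
Proof.
move=> yk h; rewrite /rank (bigD1 (Ordinal yk)) //= [X in _ < X](bigD1 (Ordinal yk)) //=.
rewrite ltnn h add0n add1n ltnS; apply: leq_sum => z _.
by case: ltnP => // hz; rewrite (ltn_trans hz).
Qed.

(** Ranks compare like the values but lie below n, so they can index buckets where the values may be
    too large. *)
Lemma rank_ltE f k x y : y < k -> (rank f k y < rank f k x) = (f y < f x).
Proof.
move=> yk; case: (ltnP (f y) (f x)) => [|h]; first exact: rank_smono.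
by apply/negbTE; rewrite -leqNgt rank_mono.
Qed.

Lemma rank_lt f k x : x < k -> rank f k x < k.
Proof.
elim: k => // k IH; rewrite rankS ltnS leq_eqVlt => /orP[/eqP->|/IH].
  by rewrite ltnn addn0 ltnS rank_le.
by case: (f k < f x); lia.
Qed.

(* Array numbers: 0 the matrix D, 1 the adjacency matrix, 2 the times with
   infinity replaced by a large number, 3 their complements, 4 and 5 the ranks
   in the columns of 2 and 3, 6 buckets, 7 and 8 prefix maxima of the buckets,
   9 one more than the predecessors, 10 a scalar. *)
Definition max_cmd : cmd :=
  For (For (If (Get 10 (Cst 0) (Cst 0)) (Get 0 (Var 1) (Var 2))
    (Store 10 (Cst 0) (Cst 0) (Get 0 (Var 1) (Var 2))) Skip)).

(** [Var 1] is the bound [B]; an input entry below 1 encodes infinity. *)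
Definition times_cmd : cmd :=
  For (For (Seq
    (If (Get 0 (Var 2) (Var 3)) (Cst 1) (Store 2 (Var 2) (Var 3) (Var 1))
      (Store 2 (Var 2) (Var 3) (Get 0 (Var 2) (Var 3))))
    (Store 3 (Var 2) (Var 3) (Dif (Var 1) (Get 2 (Var 2) (Var 3)))))).

(** The result is transposed: row [v] of [dst] holds the ranks within column [v] of [src]. *)
Definition rank_cmd (src dst : nat) : cmd :=
  For (For (For (If (Get src (Var 4) (Var 2)) (Get src (Var 3) (Var 2))
    (Store dst (Var 2) (Var 3) (Add (Get dst (Var 2) (Var 3)) (Cst 1))) Skip))).

(** Variables 2 and 3 are the pair [v], [w] and [Var 4] runs over [y]: cell r receives the maximum
    of [src y w] over the [y] of rank r in column [v]. *)
Definition bucket_cmd (src rk : nat) : cmd :=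
  For (If (Get 6 (Cst 0) (Get rk (Var 2) (Var 4))) (Get src (Var 4) (Var 3))
    (Store 6 (Cst 0) (Get rk (Var 2) (Var 4)) (Get src (Var 4) (Var 3))) Skip).

(** The prefix maxima are exclusive, cell i + 1 combining cell i with bucket i; the outer test keeps
    i + 1 in range. *)
Definition prefix_cmd (q : nat) : cmd :=
  For (If (Add (Var 4) (Cst 1)) (Var 0)
    (If (Get q (Cst 0) (Var 4)) (Get 6 (Cst 0) (Var 4))
      (Store q (Cst 0) (Add (Var 4) (Cst 1)) (Get 6 (Cst 0) (Var 4)))
      (Store q (Cst 0) (Add (Var 4) (Cst 1)) (Get q (Cst 0) (Var 4)))) Skip).

Definition scan_cmd (src rk q : nat) : cmd :=
  Seq (For (Store 6 (Cst 0) (Var 4) (Cst 0)))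
    (Seq (bucket_cmd src rk) (Seq (Store q (Cst 0) (Cst 0) (Cst 0)) (prefix_cmd q))).

(** For each [x]: the time to [v] is finite, that to [w] is smaller, and both prefix maxima at the
    rank of [x] are small enough. The last two tests detect failure, so success is in the else
    branches. *)
Definition test_cmd : cmd :=
  For (If (Get 2 (Var 4) (Var 2)) (Var 1)
    (If (Get 2 (Var 4) (Var 3)) (Get 2 (Var 4) (Var 2))
      (If (Get 2 (Var 4) (Var 2)) (Get 7 (Cst 0) (Get 4 (Var 2) (Var 4))) Skip
        (If (Get 3 (Var 4) (Var 2)) (Get 8 (Cst 0) (Get 5 (Var 2) (Var 4))) Skip
          (Store 9 (Var 4) (Var 2) (Add (Var 3) (Cst 1)))))
      Skip) Skip).

Definition pred_cmd : cmd :=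
  For (For (If (Cst 0) (Get 1 (Var 2) (Var 3))
    (Seq (scan_cmd 2 4 7) (Seq (scan_cmd 3 5 8) test_cmd)) Skip)).

(** The variable bound here exceeds every encoded entry by at least one and serves as infinity. *)
Definition analyse (rest : cmd) : cmd :=
  Seq max_cmd (Let (Add (Get 10 (Cst 0) (Cst 0)) (Cst 1))
    (Seq times_cmd (Seq (rank_cmd 2 4) (Seq (rank_cmd 3 5) (Seq pred_cmd rest))))).

Definition check_cmd : cmd :=
  Seq (Store 10 (Cst 0) (Cst 0) (Cst 0)) (Seq
    (For (For (If (Get 2 (Var 2) (Var 3)) (Var 1)
      (If (Cst 1) (Get 2 (Var 2) (Var 3))
        (If (Get 9 (Var 2) (Var 3)) (Cst 1) (Store 10 (Cst 0) (Cst 0) (Cst 1)) Skip)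
        Skip) Skip)))
    (Print (Dif (Cst 1) (Get 10 (Cst 0) (Cst 0))))).

Definition if_eq (e1 e2 : expr) (c : cmd) : cmd := If e1 e2 Skip (If e2 e1 Skip c).

(** Variables 3 to 6 hold v, w, the shifted time t and the source currently scanned. *)
Definition clear_at (i j : nat) : cmd :=
  if_eq (Get 9 (Var 6) (Var i)) (Add (Var j) (Cst 1))
    (if_eq (Get 2 (Var 6) (Var i)) (Var 5) (Store 9 (Var 6) (Var i) (Cst 0))).

Definition clear_cmd : cmd := For (Seq (clear_at 3 4) (clear_at 4 3)).

(** After printing a label, all pairs yielding the same label of the same edge are erased. This
    prevents repetitions with one linear scan per printed label. *)
Definition output_cmd : cmd :=
  For (For (If (Cst 0) (Get 9 (Var 2) (Var 3))
    (Let (Dif (Get 9 (Var 2) (Var 3)) (Cst 1)) (Let (Get 2 (Var 2) (Var 3))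
      (Seq (If (Var 3) (Var 4) (Seq (Print (Var 3)) (Print (Var 4)))
                               (Seq (Print (Var 4)) (Print (Var 3))))
        (Seq (Print (Dif (Var 5) (Cst 1))) clear_cmd))))
    Skip)).

(** * Verification of the individual commands *)

Section Analysis.

Variables (W n : nat).
Hypothesis nW : n < W.
Hypothesis W1 : 1 < W.
Local Notation wp := (wp W 11 n).

Lemma max_cmd_ok Mx Q m o : 0 < n ->
  (forall u v, u < n -> v < n -> m 0 u v <= Mx) -> m 10 0 0 = 0 ->
  (forall m', same [:: 10] m m' -> m' 10 0 0 <= Mx ->
    (forall u v, u < n -> v < n -> m 0 u v <= m' 10 0 0) -> Q m' o) ->
  wp max_cmd [:: n] Q m o.
Proof.
move=> n0 mM m0 hQ.
apply: (wp_for2 (I := fun i j m' o' => [/\ o' = o, same [:: 10] m m', m' 10 0 0 <= Mx &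
  forall u v, v < n -> lex i j u v -> m 0 u v <= m' 10 0 0])).
- by split=> // [|u v _]; rewrite ?m0 ?lex00.
- move=> i j m' _ hi hj [-> s le h] /=; split; first by lia.
  have E : m' 0 i j = m 0 i j by exact: s.
  rewrite E; case: ltnP => lt.
    split; first by lia.
    split=> //; [exact: same_upd|by rewrite updE; apply: mM|].
    move=> u v hv; rewrite updE /= /lex => H.
    have [/andP[/eqP->/eqP->]|ne] := boolP ((u == i) && (v == j)) => //.
    by apply: leq_trans (h u v hv _) (ltnW lt); move: H ne; rewrite /lex; lia.
  split=> // u v hv H.
  have [/andP[/eqP->/eqP->]|ne] := boolP ((u == i) && (v == j)) => //.
  by apply: h => //; move: H ne; rewrite /lex; lia.
- move=> i m' o' hi [-> s le h]; split=> // u v hv H; apply: h => //.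
  by move: H; rewrite /lex; lia.
- move=> m' o' [-> s le h]; apply: hQ => // u v hu hv; apply: h => //.
  by rewrite /lex hu.
Qed.

Definition time_of (B x : nat) : nat := if x < 1 then B else x.

Lemma times_cmd_ok B Q m o :
  (forall m', same [:: 2; 3] m m' ->
    (forall u v, u < n -> v < n -> m' 2 u v = time_of B (m 0 u v)) ->
    (forall u v, u < n -> v < n -> m' 3 u v = B - time_of B (m 0 u v)) -> Q m' o) ->
  wp times_cmd [:: n; B] Q m o.
Proof.
move=> hQ.
apply: (wp_for2 (I := fun i j m' o' => [/\ o' = o, same [:: 2; 3] m m' &
  forall u v, u < n -> v < n -> lex i j u v ->
    m' 2 u v = time_of B (m 0 u v) /\ m' 3 u v = B - time_of B (m 0 u v)])).
- by split=> // u v; rewrite lex00.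
- move=> i j m' _ hi hj [-> s h] /=; split; first by lia.
  have E : m' 0 i j = m 0 i j by exact: s.
  have step x : x = time_of B (m 0 i j) ->
      [/\ o = o, same [:: 2; 3] m (upd (upd m' 2 i j x) 3 i j (B - upd m' 2 i j x 2 i j)) &
      forall u v, u < n -> v < n -> lex i j.+1 u v ->
      upd (upd m' 2 i j x) 3 i j (B - upd m' 2 i j x 2 i j) 2 u v = time_of B (m 0 u v) /\
      upd (upd m' 2 i j x) 3 i j (B - upd m' 2 i j x 2 i j) 3 u v = B - time_of B (m 0 u v)].
    move=> ->; split=> //; first by apply: same_upd => //; apply: same_upd.
    move=> u v hu hv H; rewrite updE upd_neq // !updE !eqxx /= upd_neq //.
    have [/andP[/eqP->/eqP->]|ne] := boolP ((u == i) && (v == j)) => //.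
    by apply: h => //; move: H ne; rewrite /lex; lia.
  case: ifP => lt; (split; first by lia); (split; first by lia); apply: step.
    by rewrite /time_of -E lt.
  by rewrite /time_of -E lt.
- move=> i m' o' hi [-> s h]; split=> // u v hu hv H; apply: h => //.
  by move: H; rewrite /lex; lia.
- move=> m' o' [-> s h]; apply: hQ => // u v hu hv; apply h => //; rewrite /lex hu //.
Qed.

Lemma rank_cmd_ok src dst B Q m o : src < 11 -> dst < 11 -> src != dst ->
  (forall v x, m dst v x = 0) ->
  (forall m', same [:: dst] m m' ->
    (forall v x, v < n -> x < n -> m' dst v x = rank (fun y => m src y v) n x) ->
    Q m' o) ->
  wp (rank_cmd src dst) [:: n; B] Q m o.
Proof.
move=> hs hd sd m0 hQ.
apply: (wp_for2 (I := fun i j m' o' => [/\ o' = o, same [:: dst] m m' &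
  forall v x, v < n -> x < n -> m' dst v x =
    if lex i j v x then rank (fun y => m src y v) n x else 0])).
- by split=> // v x _ _; rewrite m0 lex00.
- move=> i j m' _ hi hj [-> s h] /=.
  exists (fun k m' o' => [/\ o' = o, same [:: dst] m m' &
    forall v x, v < n -> x < n -> m' dst v x =
      if lex i j v x then rank (fun y => m src y v) n x else
      if (v == i) && (x == j) then rank (fun y => m src y v) k x else 0]); split.
  + split=> // v x hv hx; rewrite h //; case: ifP => // _; case: ifP => //.
    by rewrite /rank big_ord0.
  + move=> k m1 _ hk [-> s1 h1] /=; split; first by lia.
    have E y : m1 src y i = m src y i by apply: s1; rewrite inE.
    have lij : lex i j i j = false by rewrite /lex; lia.
    have V : m1 dst i j = rank (fun y => m src y i) k j by rewrite h1 // lij !eqxx.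
    have := rank_le (fun y => m src y i) k j; rewrite !E => le.
    case: ifP => lt.
      split; first by rewrite V; lia.
      split=> //; first by apply: same_upd => //; rewrite inE.
      move=> v x hv hx; rewrite updE rankS.
      have [/andP[/eqP->/eqP->]|ne] := boolP ((v == i) && (x == j)).
        by rewrite lij V lt.
      by rewrite h1 // (negPf ne).
    split=> // v x hv hx; rewrite h1 // rankS.
    by have [/andP[/eqP->/eqP->]|ne] := boolP ((v == i) && (x == j)); rewrite ?lt ?addn0.
  + move=> m1 _ [-> s1 h1]; split=> // v x hv hx; rewrite h1 //.
    have [/andP[/eqP->/eqP->]|ne] := boolP ((v == i) && (x == j)).
      by rewrite /lex !ltnn eqxx ltnSn.
    by congr (if _ then _ else _); move: ne; rewrite /lex; lia.
- move=> i m' o' hi [-> s h]; split=> // v x hv hx; rewrite h //.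
  by congr (if _ then _ else _); rewrite /lex; lia.
- by move=> m' o' [-> s h]; apply: hQ => // v x hv hx; rewrite h // /lex hv.
Qed.

(** A maximum is described by the thresholds [t] it does not exceed; this covers the empty set, with
    maximum 0, and makes combining maxima a conjunction. *)
Lemma scan_cmd_ok src rk q B v w Q m o : src < 6 -> rk < 6 -> 6 < q < 11 ->
  v < n -> w < n -> (forall x, x < n -> m rk v x < n) ->
  (forall m', same [:: 6; q] m m' ->
    (forall r t, r < n -> (m' q 0 r <= t) <->
      (forall y, y < n -> m rk v y < r -> m src y w <= t)) -> Q m' o) ->
  wp (scan_cmd src rk q) [:: n; B; v; w] Q m o.
Proof.
move=> hs hr hq hv hw rkn hQ.
have n0 : 0 < n by lia.
have sl : src \notin [:: 6; q] by rewrite !inE; lia.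
have rl : rk \notin [:: 6; q] by rewrite !inE; lia.
have q6 : 6 != q by lia.
have ql : q \in [:: 6; q] by rewrite !inE eqxx orbT.
exists (fun i m' o' => [/\ o' = o, same [:: 6; q] m m' &
  forall r, r < i -> m' 6 0 r = 0]); split=> //.
  move=> i m' _ hi [-> s h] /=; split; first by lia.
  split=> //; first exact: same_upd.
  move=> r; rewrite updE /= ltnS leq_eqVlt; case: eqP => //= _; exact: h.
move=> m1 _ [-> s1 h1].
exists (fun i m' o' => [/\ o' = o, same [:: 6; q] m m' &
  forall r t, r < n -> (m' 6 0 r <= t) <->
    (forall y, y < i -> m rk v y = r -> m src y w <= t)]); split=> //.
- by split=> // r t hr'; rewrite h1.
- move=> i m' _ hi [-> s h] /=; rewrite !(s src) // !(s rk) //.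
  have ri := rkn _ hi.
  split; first by lia.
  case: ltnP => lt.
    split; first by lia.
    split=> //; first exact: same_upd.
    move=> r t hr'; rewrite updE /=; case: eqP => [Er|ne].
      split=> [le y|H]; last by apply: H; rewrite ?Er.
      rewrite ltnS leq_eqVlt => /orP[/eqP-> _ //|yi Ey].
      by apply: (h r t hr').1 => //; rewrite Er; lia.
    rewrite h //; split=> H y; last by move=> yi; apply: H; lia.
    rewrite ltnS leq_eqVlt => /orP[/eqP-> E|]; last exact: H.
    by case: ne.
  split=> // r t hr'; rewrite h //; split=> H y; last by move=> yi; apply: H; lia.
  rewrite ltnS leq_eqVlt => /orP[/eqP-> E|]; last exact: H.
  by rewrite (leq_trans lt) // E; apply/h.
move=> m2 _ [-> s2 h2]; split; first by rewrite /=; lia.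
exists (fun i m' o' => [/\ o' = o, same [:: 6; q] m m' &
  (forall r t, r < n -> (m' 6 0 r <= t) <->
    (forall y, y < n -> m rk v y = r -> m src y w <= t)) /\
  (forall r t, r < n -> r <= i -> (m' q 0 r <= t) <->
    (forall y, y < n -> m rk v y < r -> m src y w <= t))]); split.
- split=> //; first exact: same_upd.
  split=> r t hr'; first by rewrite upd_neq // h2.
  by rewrite leqn0 => /eqP->; rewrite updE; split.
- move=> i m' _ hi [-> s [hA hB]] /=; split; first by lia.
  (* Either branch stores the larger of the previous prefix maximum and bucket [i]. *)
  have key x : i.+1 < n -> (forall t, x <= t <-> m' q 0 i <= t /\ m' 6 0 i <= t) ->
    [/\ o = o, same [:: 6; q] m (upd m' q 0 i.+1 x) &
      (forall r t, r < n -> (upd m' q 0 i.+1 x 6 0 r <= t) <->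
        (forall y, y < n -> m rk v y = r -> m src y w <= t)) /\
      (forall r t, r < n -> r <= i.+1 -> (upd m' q 0 i.+1 x q 0 r <= t) <->
        (forall y, y < n -> m rk v y < r -> m src y w <= t))].
    move=> i1 hx; split=> //; first exact: same_upd.
    split=> r t hr'; first by rewrite upd_neq // hA.
    rewrite updE /= leq_eqVlt; case: eqP => [-> _|_ /= ri]; last exact: hB.
    rewrite hx hA // hB //; split=> [[H1 H2] y yn|H].
      rewrite ltnS leq_eqVlt => /orP[/eqP|]; [exact: H2|exact: H1].
    by split=> y yn h; apply: H => //; lia.
  rewrite addn1; case: ifP => [lt|ge].
    split; first by lia.
    case: ltnP => lt'; (split; first by lia).
      by apply: key => // t; split; [lia|case].
    by apply: key => // t; split; [lia|case].
  split=> //; split=> // r t hr' ri; apply: hB => //; lia.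
- move=> m' _ [-> s [hA hB]]; apply: hQ => // r t hr'; apply: hB => //; lia.
Qed.

(** The counterpart of [good] for matrices with natural-number indices. *)
Definition goodn (adj e : nat -> nat -> nat) (B x v w : nat) : Prop :=
  [/\ 0 < adj v w, e x w < e x v, e x v < B & forall y, y < n ->
    (e y v < e x v -> e y w <= e x v) /\ (e y w < e x v -> e y v <= e x v)].

(** Entry 0 means no predecessor and [w.+1] means [w]. Entries are always sound; completeness is
    claimed only for the candidates in [done]. *)
Definition pred_ok (adj e : nat -> nat -> nat) (B : nat)
    (done : nat -> nat -> nat -> bool) (p : nat -> nat -> nat) : Prop :=
  forall x v, x < n -> v < n ->
    (forall w, p x v = w.+1 -> w < n /\ goodn adj e B x v w) /\
    (p x v = 0 -> forall w, w < n -> done x v w -> ~ goodn adj e B x v w).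

Lemma pred_ok_sub adj e B (done done' : nat -> nat -> nat -> bool) p :
  (forall x v w, x < n -> v < n -> w < n -> done' x v w -> done x v w) ->
  pred_ok adj e B done p -> pred_ok adj e B done' p.
Proof.
move=> sub h x v hx hv; have [h1 h2] := h x v hx hv; split=> // p0 w hw /sub d.
by apply: h2 => //; apply: d.
Qed.

Lemma test_cmd_ok B v w Q m o :
  v < n -> w < n -> 0 < m 1 v w ->
  (forall x y, x < n -> y < n -> m 2 x y <= B) ->
  (forall x y, x < n -> y < n -> m 3 x y = B - m 2 x y) ->
  (forall x, x < n -> m 4 v x < n) -> (forall x, x < n -> m 5 v x < n) ->
  (forall x t, x < n -> (m 7 0 (m 4 v x) <= t) <->
    (forall y, y < n -> m 2 y v < m 2 x v -> m 2 y w <= t)) ->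
  (forall x t, x < n -> (m 8 0 (m 5 v x) <= t) <->
    (forall y, y < n -> m 3 y v < m 3 x v -> m 3 y w <= t)) ->
  pred_ok (m 1) (m 2) B (fun _ => lex v w) (m 9) ->
  (forall m', same [:: 9] m m' ->
    pred_ok (m 1) (m 2) B (fun _ => lex v w.+1) (m' 9) -> Q m' o) ->
  wp test_cmd [:: n; B; v; w] Q m o.
Proof.
move=> hv hw adj leB eF r4 r5 q7 q8 p0 hQ.
exists (fun k m' o' => [/\ o' = o, same [:: 9] m m' &
  pred_ok (m 1) (m 2) B (fun x v' w' => lex v w v' w' || [&& v' == v, w' == w & x < k])
    (m' 9)]); split.
- by split=> //; apply: pred_ok_sub p0 => x v' w' _ _ _; rewrite !andbF orbF.
- move=> k m' _ hk [-> s h].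
  (* The second half of admissibility is contraposed: a time to [v] above that of [x] forces a time
     to [w] not below it. Complementing in [B] reverses the order and gives the bound on array 8. *)
  have G : goodn (m 1) (m 2) B k v w <->
      [/\ m 2 k v < B, m 2 k w < m 2 k v, m 7 0 (m 4 v k) <= m 2 k v &
          m 8 0 (m 5 v k) <= m 3 k v].
    split=> [[_ h1 h2 h3]|[h1 h2 /(q7 _ _ hk) h3 /(q8 _ _ hk) h4]]; split=> //.
    + by apply/q7 => // y hy; apply h3.
    + apply/q8 => // y hy; rewrite !eF // => lt; have [_ h4] := h3 _ hy.
      by have := leB k v hk hv; have := leB y v hy hv; have := leB y w hy hw; lia.
    + move=> y hy; split; first exact: h3.
      have := h4 _ hy; rewrite !eF // => h5 lt.
      by have := leB k v hk hv; have := leB y v hy hv; have := leB y w hy hw; lia.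
  have skip : ~ goodn (m 1) (m 2) B k v w -> [/\ o = o, same [:: 9] m m' &
      pred_ok (m 1) (m 2) B (fun x v' w' => lex v w v' w' || [&& v' == v, w' == w & x < k.+1])
      (m' 9)].
    move=> nG; split=> // x v' hx hv'; have [h1 h2] := h x v' hx hv'; split=> // px w' hw'.
    have [/and3P[/eqP-> /eqP-> /eqP->] _ //|ne] := boolP [&& v' == v, w' == w & x == k].
    by move=> d; apply: h2 => //; move: d ne; lia.
  rewrite /= !(s 2) // !(s 3) // !(s 4) // !(s 5) // !(s 7) // !(s 8) //.
  have ri := r4 _ hk; have si := r5 _ hk.
  split; first by lia.
  case: ltnP => c1; last by apply: skip => /G[]; rewrite ltnNge c1.
  split; first by lia.
  case: ltnP => c2; last by apply: skip => /G[_]; rewrite ltnNge c2.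
  split; first by lia.
  case: ltnP => c3; first by apply: skip => /G[_ _]; rewrite leqNgt c3.
  split; first by lia.
  case: ltnP => c4; first by apply: skip => /G[_ _ _]; rewrite leqNgt c4.
  split; first by lia.
  split=> //; first exact: same_upd.
  move=> x v' hx hv'; rewrite updE.
  have [/andP[/eqP-> /eqP->]|ne] := boolP ((x == k) && (v' == v)).
    by split=> [w'|]; rewrite addn1 // => -[<-]; split=> //; apply/G.
  have [h1 h2] := h x v' hx hv'; split=> // px w' hw' d.
  by apply: h2 => //; move: d ne; lia.
- move=> m' _ [-> s h]; apply: hQ => //; apply: pred_ok_sub h => x v' w' hx hv' hw'.
  by rewrite /lex; lia.
Qed.

Lemma pred_cmd_ok B Q m o :
  (forall x y, x < n -> y < n -> m 2 x y <= B) ->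
  (forall x y, x < n -> y < n -> m 3 x y = B - m 2 x y) ->
  (forall v x, v < n -> x < n -> m 4 v x = rank (fun y => m 2 y v) n x) ->
  (forall v x, v < n -> x < n -> m 5 v x = rank (fun y => m 3 y v) n x) ->
  (forall x v, m 9 x v = 0) ->
  (forall m', same [:: 6; 7; 8; 9] m m' ->
    pred_ok (m 1) (m 2) B (fun _ _ _ => true) (m' 9) -> Q m' o) ->
  wp pred_cmd [:: n; B] Q m o.
Proof.
move=> leB eF e4 e5 m9 hQ.
have r4 v x : v < n -> x < n -> m 4 v x < n by move=> hv hx; rewrite e4 // rank_lt.
have r5 v x : v < n -> x < n -> m 5 v x < n by move=> hv hx; rewrite e5 // rank_lt.
apply: (wp_for2 (I := fun i j m' o' => [/\ o' = o, same [:: 6; 7; 8; 9] m m' &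
  pred_ok (m 1) (m 2) B (fun _ => lex i j) (m' 9)])).
- by split=> // x v hx hv; split=> [w|_ w _]; rewrite ?m9 // lex00.
- move=> v w m' _ hv hw [-> s h]; rewrite -[rcons _ _]/[:: n; B; v; w].
  apply: wp_if; [by rewrite /=; lia| |] => adj; rewrite /= (s 1) // in adj; last first.
    split=> // x v' hx hv'; have [h1 h2] := h x v' hx hv'; split=> // px w' hw' l [].
    have [/andP[/eqP-> /eqP->]|ne] := boolP ((v' == v) && (w' == w)); first by rewrite ltnNge adj.
    by move=> *; apply: (h2 px w' hw') => //; move: l ne; rewrite /lex; lia.
  apply: wp_seq; apply: scan_cmd_ok => //; first by move=> x hx; rewrite (s 4) // r4.
  move=> m1 s1 h1; apply: wp_seq; apply: scan_cmd_ok => //.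
    by move=> x hx; rewrite (s1 5) // (s 5) // r5.
  move=> m2 s2 h2.
  have sm2 : same [:: 6; 7; 8; 9] m m2.
    apply: same_trans s _; apply: (same_trans (m2 := m1)).
      by apply: same_sub s1 => a; rewrite !inE => /orP[]->; rewrite ?orbT.
    by apply: same_sub s2 => a; rewrite !inE => /orP[]->; rewrite ?orbT.
  have E a : a \notin [:: 6; 7; 8; 9] -> m2 a = m a.
    by move=> al; apply/funext => i; apply/funext => j; apply: sm2.
  apply: test_cmd_ok => //; rewrite ?(E 1) ?(E 2) ?(E 3) ?(E 4) ?(E 5) //.
  + by move=> x; apply: r4.
  + by move=> x; apply: r5.
  + move=> x t hx; rewrite (s2 7) // h1 ?r4 //.
    by split=> H y hy; have := H y hy; rewrite (s 4) // !(s 2) // !e4 // rank_ltE.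
  + move=> x t hx; rewrite h2 ?r5 //.
    by split=> H y hy; have := H y hy;
      rewrite (s1 5) // !(s1 3) // (s 5) // !(s 3) // !e5 // rank_ltE.
  + move=> x v' hx hv'; rewrite (s2 9) // (s1 9) //; exact: h.
  + move=> m3 s3 h3; split=> //; apply: same_trans sm2 _; apply: same_sub s3 => a.
    by rewrite !inE => ->; rewrite !orbT.
- move=> i m' _ hi [-> s h]; split=> //; apply: pred_ok_sub h => x v w _ _ hw.
  by rewrite /lex; lia.
- move=> m' _ [-> s h]; apply: hQ => //; apply: pred_ok_sub h => x v w _ hv _ _.
  by rewrite /lex hv.
Qed.

Lemma analyse_ok Mx rest Q m o : 0 < n -> Mx.+1 < W ->
  (forall u v, u < n -> v < n -> m 0 u v <= Mx) ->
  (forall a i j, 1 < a -> m a i j = 0) ->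
  (forall B m', let e u v := time_of B (m 0 u v) in
    (forall u v, u < n -> v < n -> m 0 u v < B) ->
    (forall u v, u < n -> v < n -> m' 2 u v = e u v) ->
    pred_ok (m 1) e B (fun _ _ _ => true) (m' 9) ->
    wp rest [:: n; B] Q m' o) ->
  wp (analyse rest) [:: n] Q m o.
Proof.
move=> n0 MW leM m0 hQ.
apply: wp_seq; apply: (max_cmd_ok (Mx := Mx)) => //; first exact: m0.
move=> m1 s1 leC leD; split; first by rewrite /=; lia.
rewrite -[rcons _ _]/[:: n; m1 10 0 0 + 1]; set B := _ + 1.
have dB u v : u < n -> v < n -> m 0 u v < B by move=> hu hv; rewrite /B addn1 ltnS leD.
apply: wp_seq; apply: times_cmd_ok => m2 s2 e2 e3.
apply: wp_seq; apply: rank_cmd_ok => //.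
  by move=> v x; rewrite s2 // s1 // m0.
move=> m3 s3 e4; apply: wp_seq; apply: rank_cmd_ok => //.
  by move=> v x; rewrite s3 // s2 // s1 // m0.
move=> m4 s4 e5; apply: wp_seq; apply: pred_cmd_ok => //.
- move=> x y hx hy; rewrite s4 // s3 // e2 // /time_of s1 //.
  by have := dB x y hx hy; case: ifP; lia.
- by move=> x y hx hy; rewrite !(s4 _ x) // !(s3 _ x) // e2 // e3.
- move=> v x hv hx; rewrite s4 // e4 //; apply: eq_bigr => y _.
  by rewrite !(s4 2) // !(s3 2).
- by move=> v x hv hx; rewrite e5 //; apply: eq_bigr => y _; rewrite !(s4 3).
- by move=> x v; rewrite s4 // s3 // s2 // s1 // m0.
move=> m5 s5 p; apply: hQ => // [u v hu hv|x v hx hv].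
  by rewrite s5 // s4 // s3 // e2 // s1.
have E2 u y : u < n -> y < n -> m4 2 u y = time_of B (m 0 u y).
  by move=> hu hy; rewrite s4 // s3 // e2 // s1.
have E1 : m4 1 = m 1.
  by apply/funext => i; apply/funext => j; rewrite s4 // s3 // s2 // s1.
have gE w : w < n -> goodn (m4 1) (m4 2) B x v w <->
    goodn (m 1) (fun u v => time_of B (m 0 u v)) B x v w.
  move=> hw; rewrite /goodn E1 !E2 //.
  by split=> -[h1 h2 h3 h4]; split=> // y hy; have := h4 y hy; rewrite !E2.
have [h1 h2] := p x v hx hv; split=> [w /h1[hw g]|p0 w hw d g].
  by split=> //; apply/gE.
by apply: (h2 p0 w hw d); apply/gE.
Qed.

(** Key 1 is distance 0, found only on the diagonal, so the range singles out the finite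
    off-diagonal entries. *)
Definition full (B : nat) (e p : nat -> nat -> nat) : Prop :=
  forall u v, u < n -> v < n -> 1 < e u v < B -> 0 < p u v.

Lemma check_cmd_ok B Q m o : 0 < n ->
  (forall m' b, (b = 1 /\ full B (m 2) (m 9)) \/ (b = 0 /\ ~ full B (m 2) (m 9)) ->
    Q m' (rcons o b)) ->
  wp check_cmd [:: n; B] Q m o.
Proof.
move=> n0 hQ; split; first by rewrite /=; lia.
apply: wp_seq.
apply: (wp_for2 (I := fun i j m' o' => [/\ o' = o, same [:: 10] m m' &
  (m' 10 0 0 = 0 /\ forall u v, u < n -> v < n -> lex i j u v -> 1 < m 2 u v < B -> 0 < m 9 u v)
  \/ (m' 10 0 0 = 1 /\ ~ full B (m 2) (m 9))])).
- by split=> //; [exact: same_upd|left; split=> // u v _ _; rewrite lex00].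
- move=> i j m' _ hi hj [-> s h].
  have skip : (1 < m 2 i j < B -> 0 < m 9 i j) -> [/\ o = o, same [:: 10] m m' &
    (m' 10 0 0 = 0 /\ forall u v, u < n -> v < n -> lex i j.+1 u v -> 1 < m 2 u v < B -> 0 < m 9 u v)
    \/ (m' 10 0 0 = 1 /\ ~ full B (m 2) (m 9))].
    move=> hp; split=> //; case: h => -[h1 h2]; [left|by right].
    split=> // u v hu hv l.
    have [/andP[/eqP-> /eqP->] //|ne] := boolP ((u == i) && (v == j)).
    by apply: h2 => //; move: l ne; rewrite /lex; lia.
  rewrite /= !(s 2) // !(s 9) //; split; first by lia.
  case: ltnP => c1; last by apply: skip; lia.
  split; first by lia.
  case: ltnP => c2; last by apply: skip; lia.
  split; first by lia.
  case: ltnP => c3; last by apply: skip.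
  split; first by lia.
  split=> //; [exact: same_upd|right; split=> // F].
  by have := F i j hi hj; rewrite c1 c2 => /(_ isT); lia.
- move=> i m' _ hi [-> s [[h1 h2]|h]]; split=> //; [left|by right]; split=> // u v hu hv l.
  by apply: h2 => //; move: l; rewrite /lex; lia.
- move=> m' _ [-> s h] /=; split; first by lia.
  apply: hQ; case: h => -[-> h]; [left|by right]; split=> // u v hu hv.
  by apply: h; rewrite // /lex hu.
Qed.

Definition triple (a : nat * nat * nat) : seq nat := [:: a.1.1; a.1.2; a.2].

(** The labels to be printed, with the smaller end of the edge first; [e] holds times shifted by
    one. *)
Definition lab (e p : nat -> nat -> nat) (a b t : nat) : Prop :=
  exists x v w, [/\ x < n, v < n, p x v = w.+1, e x v = t.+1 & (a, b) = (minn v w, maxn v w)].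

(* The pairs (x, y) giving rise to the label t of the edge vw. *)
Definition hit (e p : nat -> nat -> nat) (v w t x y : nat) : bool :=
  (e x y == t) && ((y == v) && (p x y == w.+1) || (y == w) && (p x y == v.+1)).

(** Minimum and maximum represent an unordered edge, so being hit amounts to yielding the same
    label. *)
Lemma hitP e p v w t x y w' : p x y = w'.+1 ->
  hit e p v w t x y = (e x y == t) && ((minn y w', maxn y w') == (minn v w, maxn v w)).
Proof.
rewrite /hit => ->; rewrite !eqSS xpair_eqE; congr (_ && _).
by apply/idP/idP; lia.
Qed.

Lemma wp_if_eq e1 e2 c env Q m o :
  safe W 11 n env m e1 && safe W 11 n env m e2 ->
  (eval env m e1 = eval env m e2 -> wp c env Q m o) ->
  (eval env m e1 <> eval env m e2 -> Q m o) ->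
  wp (if_eq e1 e2 c) env Q m o.
Proof.
move=> h h1 h2; apply: wp_if => // [lt|ge]; first by apply: h2; lia.
apply: wp_if => [|lt|ge']; first by rewrite andbC.
  by apply: h2; lia.
by apply: h1; lia.
Qed.

Lemma clear_at_ok i j env k t y z Q m o :
  nth 0 env 6 = k -> nth 0 env 5 = t -> nth 0 env i = y -> nth 0 env j = z ->
  size env = 7 -> i < 7 -> j < 7 -> y < n -> z < n -> k < n ->
  (forall m', same [:: 9] m m' ->
    (forall x' y', m' 9 x' y' =
      if [&& x' == k, y' == y, m 2 k y == t & m 9 k y == z.+1] then 0 else m 9 x' y') ->
    Q m' o) ->
  wp (clear_at i j) env Q m o.
Proof.
move=> ek et ey ez se hi hj hy hz hk hQ.
have skip : (m 2 k y == t) && (m 9 k y == z.+1) = false -> Q m o.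
  by move=> E; apply: hQ => // x' y'; rewrite E !andbF.
apply: wp_if_eq => [|E1|E1].
- by rewrite /= se ek ey ez; lia.
- rewrite /= ek ey ez in E1; apply: wp_if_eq => [|E2|E2].
  + by rewrite /= se ek ey; lia.
  + rewrite /= ek ey et in E2; split; rewrite /= ?se ek ey; first by lia.
    apply: hQ; first exact: same_upd.
    by move=> x' y'; rewrite updE E1 E2 addn1 !eqxx !andbT.
  + by rewrite /= ek ey et in E2; apply: skip; lia.
- by rewrite /= ek ey ez in E1; apply: skip; lia.
Qed.

(** As [v != w], the two clearing steps of a round touch different cells and do not disturb each
    other's tests. *)
Lemma clear_cmd_ok B u v w t Q m o : v < n -> w < n -> v != w ->
  (forall m', same [:: 9] m m' ->
    (forall x y, x < n -> y < n ->
      m' 9 x y = if hit (m 2) (m 9) v w t x y then 0 else m 9 x y) -> Q m' o) ->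
  wp clear_cmd [:: n; B; u; v; w; t] Q m o.
Proof.
move=> hv hw vw hQ.
exists (fun k m' o' => [/\ o' = o, same [:: 9] m m' & forall x y, x < n -> y < n ->
   m' 9 x y = if (x < k) && hit (m 2) (m 9) v w t x y then 0 else m 9 x y]); split=> //.
- move=> k m' _ hk [-> s h]; rewrite -[rcons _ _]/[:: n; B; u; v; w; t; k].
  apply: wp_seq; apply: (clear_at_ok (k := k) (t := t) (y := v) (z := w)) => // m1 s1 h1.
  apply: (clear_at_ok (k := k) (t := t) (y := w) (z := v)) => // m2 s2 h2; split=> //.
    by apply: same_trans s _; apply: same_trans s1 s2.
  move=> x y hx hy; rewrite h2 !h1 !(s1 2) // !(s 2) // !h // ltnn !eqxx /=.
  have -> : (x < k.+1) = (x == k) || (x < k) by lia.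
  rewrite (eq_sym w v) (negPf vw) /= /hit.
  by have [->|xk] := eqVneq x k; rewrite ?ltnn /=; have [->|yw] := eqVneq y w;
    rewrite ?(eq_sym w v) ?(negPf vw) //=; have [?|yv] := eqVneq y v; subst; rewrite //= ?orbF ?andbF ?if_same.
- move=> m' _ [-> s h]; apply: hQ => // x y hx hy; by rewrite h // hx.
Qed.

Lemma output_cmd_ok B Q m o :
  (forall x v w, x < n -> v < n -> m 9 x v = w.+1 ->
    [/\ w < n, v != w & 0 < m 2 x v]) ->
  (forall m' S, uniq S -> 
    (forall a b t, (a, b, t) \in S <-> lab (m 2) (m 9) a b t) ->
    Q m' (o ++ flatten (map triple S))) ->
  wp output_cmd [:: n; B] Q m o.
Proof.
move=> p0 hQ.
(* Invariant: each label is either already printed, in [S], or still produced by the table in array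
   9, never both; processed cells are zero. *)
apply: (wp_for2 (I := fun i j m' o' => exists S, [/\ o' = o ++ flatten (map triple S),
   uniq S, same [:: 9] m m', 
   (forall u v, u < n -> v < n -> m' 9 u v = 0 \/ ~~ lex i j u v /\ m' 9 u v = m 9 u v) &
   (forall a b t, lab (m 2) (m 9) a b t <-> (a, b, t) \in S \/ lab (m 2) (m' 9) a b t) /\
   (forall a b t, (a, b, t) \in S -> ~ lab (m 2) (m' 9) a b t)])).
- exists [::]; split=> //; first by rewrite cats0.
    by move=> u v _ _; right; rewrite lex00.
  by split=> // a b t; split; [right|case].
- move=> u v m' _ hu hv [S [-> US s z [h1 h2]]].
  have E2 : m' 2 = m 2 by apply/funext => i; apply/funext => j; apply: s.
  rewrite -[rcons _ _]/[:: n; B; u; v].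
  apply: wp_if; [by rewrite /=; lia|rewrite [eval _ _ _]/= [eval _ _ _]/=|] => pos; last first.
    exists S; split=> // x y hx hy; have [->|[l E]] := z x y hx hy; first by left.
    rewrite E.
    have [/andP[/eqP Ex /eqP Ey]|ne] := boolP ((x == u) && (y == v)).
      by left; move: pos; rewrite /= -Ex -Ey E; lia.
    by right; split=> //; move: l ne; rewrite /lex; lia.
  have [E|[l E]] := z u v hu hv; first by rewrite E in pos.
  case Ew: (m' 9 u v) pos => [|w] // _.
  have [hw vw t0] := p0 u v w hu hv (etrans (esym E) Ew).
  split; first by rewrite /=; lia.
  rewrite [rcons _ _]/= Ew subn1 [w.+1.-1]/=.
  split; first by rewrite /=; lia.
  rewrite [rcons _ _]/= E2.
  set t := m 2 u v in t0 *.
  pose k := (minn v w, maxn v w, t.-1).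
  (* The invariant after clearing, common to the two orders in which the ends may be printed. *)
  have fin m1 : same [:: 9] m' m1 ->
      (forall x y, x < n -> y < n -> m1 9 x y = if hit (m' 2) (m' 9) v w t x y then 0 else m' 9 x y) ->
      exists S', [/\ o ++ flatten (map triple (rcons S k)) = o ++ flatten (map triple S'),
        uniq S', same [:: 9] m m1, 
       (forall u' v', u' < n -> v' < n -> m1 9 u' v' = 0 \/ ~~ lex u v.+1 u' v' /\ m1 9 u' v' = m 9 u' v') &
       (forall a b t, lab (m 2) (m 9) a b t <-> (a, b, t) \in S' \/ lab (m 2) (m1 9) a b t) /\
       (forall a b t, (a, b, t) \in S' -> ~ lab (m 2) (m1 9) a b t)].
    rewrite E2 => s1 hm; exists (rcons S k).
    (* Clearing removes the label [k] and, as hit pairs all yield [k], no other. *)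
    have key a b t' : lab (m 2) (m' 9) a b t' <-> (a, b, t') = k \/ lab (m 2) (m1 9) a b t'.
      split.
        case=> x [y [w' [hx hy Ep Ee Eab]]].
        have := hm x y hx hy; rewrite (hitP _ _ _ _ Ep) -Eab; case: ifP => [/andP[/eqP Et /eqP Ek]|_] Em.
          by left; rewrite /k Ek -Et Ee.
        by right; exists x, y, w'; split; rewrite // Em.
      case=> [[-> -> ->]|].
        by exists u, v, w; split; rewrite // -/t prednK.
      case=> x [y [w' [hx hy Ep Ee Eab]]]; exists x, y, w'; split=> //.
      by move: Ep; rewrite hm //; case: ifP.
    have nk a b t' : (a, b, t') = k -> ~ lab (m 2) (m1 9) a b t'.
      move=> [-> -> ->] [x [y [w' [hx hy Ep Ee Eab]]]].
      have Ep' : m' 9 x y = w'.+1 by move: Ep; rewrite hm //; case: ifP.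
      by move: Ep; rewrite hm // (hitP _ _ _ _ Ep') -Eab eqxx andbT Ee prednK // eqxx.
    split=> //.
    + rewrite rcons_uniq US andbT; apply/negP => kS.
      by case: (h2 _ _ _ kS); apply/key; left.
    + exact: same_trans s s1.
    + move=> x y hx hy; rewrite hm //; case: ifP => [_|nh]; first by left.
      have [->|[l' E']] := z x y hx hy; first by left.
      right; split=> //.
      have [/andP[/eqP Ex /eqP Ey]|ne] := boolP ((x == u) && (y == v)).
        by move: nh; rewrite Ex Ey (hitP _ _ _ _ Ew) !eqxx.
      by move: l' ne; rewrite /lex; lia.
    + split=> a b t'.
        rewrite h1 key mem_rcons inE; split.
          by case=> [->|[->|H]]; [left; rewrite orbT|left; rewrite eqxx|right].
        by case=> [/orP[/eqP->|->]|H]; [right; left|left|right; right].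
      rewrite mem_rcons inE => /orP[/eqP /nk //|/h2 H K1].
      by apply: H; apply/key; right.
  have outE : rcons (rcons (rcons (o ++ flatten (map triple S)) (minn v w)) (maxn v w)) t.-1
      = o ++ flatten (map triple (rcons S k)).
    by rewrite map_rcons flatten_rcons -!cats1 -!catA.
  apply: wp_seq; apply: wp_if => [|lt|ge]; first by [].
    rewrite /= in lt; do 2 (split; first by []).
    split; first by rewrite /=; lia.
    apply: clear_cmd_ok => // m1 s1 hm; have := fin m1 s1 hm.
    by rewrite -outE (minn_idPl (ltnW lt)) (maxn_idPr (ltnW lt)) -subn1.
  rewrite /= in ge; do 2 (split; first by []).
  split; first by rewrite /=; lia.
  apply: clear_cmd_ok => // m1 s1 hm; have := fin m1 s1 hm.
  by rewrite -outE (minn_idPr ge) (maxn_idPl ge) -subn1.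
- move=> i m' _ hi [S [-> US s z h]]; exists S; split=> // u v hu hv.
  have [->|[l E]] := z u v hu hv; first by left.
  by right; split=> //; move: l; rewrite /lex; lia.
- move=> m' _ [S [-> US s z [h1 h2]]]; apply: hQ => // a b t.
  rewrite h1; split=> [|[//|[x [v [w [hx hv Ep _ _]]]]]]; first by left.
  have [E|[+ _]] := z x v hx hv; first by rewrite E in Ep.
  by rewrite /lex hx.
Qed.

End Analysis.

(** * Correctness *)

Section Link.

Variables (x : instance) (B : nat) (adj e p : nat -> nat -> nat).
Local Notation n := (inst_n x).
Local Notation D := (inst_D x).

Hypothesis B_gt : forall u v k, D u v = Some k -> k.+1 < B.
Hypothesis eE : forall u v : 'I_n, e u v = key B u v.
Hypothesis adjE : forall u v : 'I_n, adj u v = ([set u; v] \in edges (inst_Gp x)).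
Hypothesis p_ok : pred_ok n adj e B (fun _ _ _ => true) p.

Definition par_of (u v : 'I_n) : option 'I_n :=
  if p u v is w.+1 then insub w else None.

Lemma goodnE (u v w : 'I_n) : goodn n adj e B u v w <-> good B u v w.
Proof.
rewrite /goodn /good adjE !eE lt0b; split=> -[h1 h2 h3 h4]; split=> //.
  by move=> y; have := h4 y (ltn_ord y); rewrite !eE.
by move=> y hy; have := h4 (Ordinal hy); rewrite -!eE.
Qed.

Lemma par_ofE (u v w : 'I_n) : par_of u v = Some w <-> p u v = w.+1.
Proof.
rewrite /par_of; split=> [|->]; last by rewrite valK.
by case: (p u v) => // k; case: insubP => // w' _ <- [->].
Qed.

Lemma par_of_good (u v w : 'I_n) : par_of u v = Some w -> good B u v w.
Proof.
move=> /par_ofE E; apply/goodnE.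
by have [h _] := p_ok (ltn_ord u) (ltn_ord v); have [] := h _ E.
Qed.

Lemma par_of_some (u v : 'I_n) : 0 < p u v -> par_of u v.
Proof.
rewrite /par_of; case E: (p u v) => [|k] // _.
have [h _] := p_ok (ltn_ord u) (ltn_ord v); have [hk _] := h _ E.
by rewrite insubT.
Qed.

Lemma full_par_of : full n B e p -> forall u v, u != v -> D u v != None -> par_of u v.
Proof.
move=> F u v uv Duv; apply: par_of_some; apply: F => //; rewrite eE /key.
case E: (D u v) Duv => [[|k]|] //= _; last by rewrite (B_gt E).
by move/(inst_dist (i := x)): E uv => ->; rewrite eqxx.
Qed.

(** A full table yields the graph of chosen predecessors. Conversely a realization provides a good
    [w] for each relevant pair, and completeness of the table then excludes entry 0. *)
Lemma full_realizable : full n B e p <-> realizable x.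
Proof.
split=> [F|[G RG] u v hu hv].
  exists (par_tgraph par_of_good).
  by apply: par_realization => //; apply: full_par_of.
pose u' := Ordinal hu; pose v' := Ordinal hv.
rewrite -[u]/(val u') -[v]/(val v') eE => /andP[k1 kB].
have [w /goodnE g] : exists w, good B u' v' w.
  apply: (realization_good B_gt RG).
    apply: contraTneq k1 => ->.
    by rewrite /key; have /(inst_dist (i := x) v' v').2 -> := erefl v'.
  by apply: contraTneq kB => E; rewrite /key E /= ltnn.
have [_ h] := p_ok hu hv; rewrite lt0n; apply/eqP => p0.
exact: h p0 w (ltn_ord w) isT g.
Qed.

Lemma ordinal_triples (S : seq (nat * nat * nat)) :
  (forall a b t, (a, b, t) \in S -> (a < n) && (b < n)) ->
  exists s : seq ('I_n * 'I_n * nat), S = [seq (val a.1.1, val a.1.2, a.2) | a <- s].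
Proof.
elim: S => [|[[a b] t] S IH] h; first by exists [::].
have [|s ->] := IH; first by move=> a' b' t' H; apply: (h a' b' t'); rewrite inE H orbT.
have /andP[ha hb] := h a b t (mem_head _ _).
by exists ((Ordinal ha, Ordinal hb, t) :: s).
Qed.

Lemma set2_minmax (a b v w : 'I_n) : a < b ->
  ([set a; b] == [set w; v]) = ((val a, val b) == (minn v w, maxn v w)).
Proof.
move=> ab; apply/eqP/eqP => [E|[Ea Eb]].
  have : a \in [set w; v] by rewrite -E !inE eqxx.
  have : b \in [set w; v] by rewrite -E !inE eqxx orbT.
  have : w \in [set a; b] by rewrite E !inE eqxx.
  have : v \in [set a; b] by rewrite E !inE eqxx orbT.
  by rewrite !inE -!val_eqE /= => h1 h2 h3 h4; congr (_, _); lia.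
case: (ltnP v w) Ea Eb => h /val_inj-> /val_inj-> //.
exact: setUC.
Qed.

Lemma full_correct_realization S : full n B e p -> uniq S ->
  (forall a b t, (a, b, t) \in S <-> lab n e p a b t) ->
  correct_realization x (flatten (map triple S)).
Proof.
move=> F US hS; exists (par_tgraph par_of_good); split.
- by apply: par_realization => //; apply: full_par_of.
- exact: par_num_labels.
split; first exact: par_edge_labelled.
have labP a b t : lab n e p a b t -> [/\ a < n, b < n & a < b].
  case=> u [v [w [hu hv Ep _ [-> ->]]]].
  have [h _] := p_ok hu hv; have [hw [_ ne _ _]] := h _ Ep.
  have vw : v != w by apply: contraTneq ne => ->; rewrite ltnn.
  by split; lia.
have [|s Es] := @ordinal_triples S.
  by move=> a b t /hS/labP[-> ->].
exists s; split.
- by apply: (@map_uniq _ _ (fun a : 'I_n * 'I_n * nat => (val a.1.1, val a.1.2, a.2))); rewrite -Es.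
- move=> a b t.
  have -> : ((a, b, t) \in s) = ((val a, val b, t) \in S).
    rewrite Es (mem_map (f := fun a : 'I_n * 'I_n * nat => (val a.1.1, val a.1.2, a.2)) _ _ (a, b, t)) //.
    by move=> [[a1 b1] t1] [[a2 b2] t2] /= [/val_inj-> /val_inj-> ->].
  apply/idP/and3P => [/hS L|[ab E1 E2]].
    have [_ _ ab] := labP _ _ _ L.
    suff /andP[] : ([set a; b] \in par_edges par_of) && (t \in par_label par_of [set a; b]) by [].
    apply/(par_labelP par_of_good); case: L => u [v [w [hu hv Ep Ee Eab]]].
    have [h _] := p_ok hu hv; have [hw _] := h _ Ep.
    exists (Ordinal hu), (Ordinal hv), (Ordinal hw); split.
    + by apply/par_ofE.
    + have [_ [_ _ lt _]] := h _ Ep.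
      move: Ee lt; rewrite -[u]/(val (Ordinal hu)) -[v]/(val (Ordinal hv)) eE /key.
      by case: (D _ _) => [k [->]|] //= _; rewrite ltnn.
    + by apply/eqP; rewrite set2_minmax // Eab.
  apply/hS.
  have /(par_labelP par_of_good)[u [v [w [/par_ofE Ep Ed Ee]]]] :
    ([set a; b] \in par_edges par_of) && (t \in par_label par_of [set a; b]) by apply/andP.
  exists u, v, w; split=> //; first by rewrite eE /key Ed.
  by apply/eqP; rewrite -set2_minmax // Ee.
- by rewrite Es -map_comp.
Qed.

End Link.

Lemma nth_allpairs (S T : Type) (R : Type) (f : S -> T -> R) (x0 : R) (a0 : S) (b0 : T)
    s t i j : i < size s -> j < size t ->
  nth x0 [seq f a b | a <- s, b <- t] (i * size t + j) = f (nth a0 s i) (nth b0 t j).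
Proof.
move=> + hj; elim: s i => [|a s IH] [|i] //= hi; rewrite nth_cat size_map.
  by rewrite mul0n hj (nth_map b0).
by rewrite mulSn -addnA ltnNge leq_addr /= addKn IH.
Qed.

(** * The input as initial matrices *)

Section Encoding.

Variable x : instance.
Local Notation n := (inst_n x).

Lemma nth_ord_allpairs (f : 'I_n -> 'I_n -> nat) (u v : 'I_n) :
  nth 0 [seq f a b | a <- enum 'I_n, b <- enum 'I_n] (u * n + v) = f u v.
Proof.
have := @nth_allpairs _ _ _ f 0 u v (enum 'I_n) (enum 'I_n) u v.
by rewrite size_enum_ord !nth_ord_enum => ->.
Qed.

Lemma size_ord_allpairs (f : 'I_n -> 'I_n -> nat) :
  size [seq f a b | a <- enum 'I_n, b <- enum 'I_n] = n * n.
Proof. by rewrite size_allpairs size_enum_ord. Qed.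

Definition arrays_of : arrays := fun a i j => nth 0 (enc_instance x) (addr n a i j).

Lemma size_enc : size (enc_instance x) = 1 + 2 * (n * n).
Proof. by rewrite /= size_cat !size_ord_allpairs; lia. Qed.

Lemma arrays_of0 (u v : 'I_n) : arrays_of 0 u v = enc_entry (inst_D x u v).
Proof.
rewrite /arrays_of /addr mul0n add0n add1n /= nth_cat size_ord_allpairs.
have -> : u * n + v < n * n by have := ltn_ord u; have := ltn_ord v; nia.
exact: nth_ord_allpairs.
Qed.

Lemma arrays_of1 (u v : 'I_n) : arrays_of 1 u v = ([set u; v] \in edges (inst_Gp x)).
Proof.
rewrite /arrays_of /addr mul1n mulnDl -addnA add1n /= nth_cat size_ord_allpairs.
rewrite ltnNge leq_addr /= addKn.
exact: (nth_ord_allpairs (fun u v => nat_of_bool ([set u; v] \in edges (inst_Gp x)))).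
Qed.

(** The input ends with matrix 1, so all later matrices lie in zero memory. *)
Lemma arrays_of_gt1 a i j : 1 < a -> arrays_of a i j = 0.
Proof.
move=> a1; rewrite /arrays_of nth_default // size_enc /addr.
by have : n <= a * n; nia.
Qed.

Lemma nth_enc_le i : nth 0 (enc_instance x) i <= \max_(a <- enc_instance x) a.
Proof.
case: (ltnP i (size (enc_instance x))) => h; last by rewrite nth_default.
exact: (leq_bigmax_seq (F := id)) (mem_nth 0 h) isT.
Qed.

End Encoding.

(** The scalar in matrix 10 needs a cell, so n = 0 is treated apart. *)
Definition program_cmd (empty rest : cmd) : cmd :=
  If (Cst 0) (Var 0) (analyse rest) empty.

Lemma program_ok (R : instance -> seq nat -> Prop) (x : instance) (w : nat) empty rest :
  let n := inst_n x in
  word_length_ok 2 w (enc_instance x) ->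
  (n < 2 ^ w -> 1 < 2 ^ w -> 0 < n -> forall B m', let e u v := time_of B (arrays_of x 0 u v) in
    (forall u v k, inst_D x u v = Some k -> k.+1 < B) ->
    (forall u v : 'I_n, e u v = key B u v) ->
    (forall u v, u < n -> v < n -> m' 2 u v = e u v) ->
    pred_ok n (arrays_of x 1) e B (fun _ _ _ => true) (m' 9) ->
    wp (2 ^ w) 11 n rest [:: n; B] (fun _ => R x) m' [::]) ->
  (1 < 2 ^ w -> n = 0 -> wp (2 ^ w) 11 n empty [:: n] (fun _ => R x) (arrays_of x) [::]) ->
  exists2 y, runs_within w (cost n (program_cmd empty rest) 1 + 2) (space 11 n)
    (compile (program_cmd empty rest)) (enc_instance x) y & R x y.
Proof.
move=> n; rewrite /word_length_ok size_enc -/n.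
set Mx := \max_(a <- _) a => wl hrest hempty.
have xle := nth_enc_le x; rewrite -/Mx in xle.
have n2 : n <= n * n by nia.
(* With N = n * n the input has length 1 + 2N, and (2N + 3)^2 exceeds 1 + 11N; thus exponent 2 in
   the word length suffices. *)
have sW : space 11 n < 2 ^ w.
  by apply: leq_trans wl; rewrite /space -mulnA -mulnn; move: (n * n) => N; nia.
have MW : Mx.+1 < 2 ^ w.
  by apply: leq_trans wl; rewrite -mulnn; move: (n * n) => N; nia.
have W1 : 1 < 2 ^ w by lia.
have nW : n < 2 ^ w by move: sW; rewrite /space; nia.
have [y run [_ Ry]] : exists2 y, runs_within w (cost n (program_cmd empty rest) 1 + 2) (space 11 n)
    (compile (program_cmd empty rest)) (enc_instance x) y & exists m : arrays, R x y.
  apply: (@compile_ok w 11 n _ _ (fun _ => R x)) => //.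
  - by rewrite size_enc -/n /space; nia.
  - by move=> i; have := xle i; lia.
  apply: wp_if => [|n0|n0]; first by rewrite /=; lia.
    apply: (analyse_ok nW W1 (Mx := Mx)) => //.
    + by move=> a i j; apply: arrays_of_gt1.
    + move=> B m' e dB; apply: hrest => //.
        move=> u v k E; have := dB u v (ltn_ord u) (ltn_ord v).
        by rewrite [X in X < _]arrays_of0 E.
      by move=> u v; rewrite arrays_of0 /key; case: (inst_D x u v).
  by apply: hempty => //; move: n0; rewrite /=; lia.
by exists y.
Qed.

(** The cost is cubic, and the logarithm is at least 1 from n = 2 on. The factor 8 comes from n + 1
    <= 2n. *)
Lemma bigO_cost c : depth c <= 3 ->
  bigO (fun n => cost n c 1 + 2) (fun n => n ^ 3 * trunc_log 2 n).
Proof.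
move=> dc; have [k h] := cost_bound c 1; exists (k * 8 + 2), 2 => n n2.
have l1 : 0 < trunc_log 2 n by rewrite trunc_log_gt0.
have n3 : n.+1 ^ depth c <= 8 * n ^ 3.
  apply: (@leq_trans ((2 * n) ^ 3)); last by rewrite expnMn.
  by apply: (@leq_trans (n.+1 ^ 3)); rewrite ?leq_pexp2l ?leq_exp2r //; lia.
have p3 : 0 < n ^ 3 by rewrite expn_gt0; lia.
apply: (@leq_trans ((k * 8 + 2) * n ^ 3)); last by rewrite leq_mul2l leq_pmulr ?orbT.
rewrite mulnDl leq_add //; last by rewrite leq_pmulr.
by rewrite (leq_trans (h n)) // -mulnA leq_mul2l n3 orbT.
Qed.

Lemma bigO_space K : bigO (space K) (fun n => n ^ 2).
Proof. by exists (K + 1), 1 => n n1; rewrite /space -mulnn; nia. Qed.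

Theorem theorem3p14 :
  computable_in inst_n enc_instance (fun _ : instance => True)
    correct_decision
    (fun n => n ^ 3 * trunc_log 2 n) (fun n => n ^ 2)
  /\
  computable_in inst_n enc_instance realizable
    correct_realization
    (fun n => n ^ 3 * trunc_log 2 n) (fun n => n ^ 2).
Proof.
(* For n = 0 all conditions on vertices are vacuous, so [B = 1] and zero matrices meet the
   requirements of the correctness lemmas. *)
have empty_ok (x : instance) : inst_n x = 0 ->
    [/\ forall u v k, inst_D x u v = Some k -> k.+1 < 1,
        forall u v : 'I_(inst_n x), 0 = key 1 u v,
        forall u v : 'I_(inst_n x), 0 = ([set u; v] \in edges (inst_Gp x)) :> nat,
        pred_ok (inst_n x) (fun _ _ => 0) (fun _ _ => 0) 1 (fun _ _ _ => true) (fun _ _ => 0) &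
        full (inst_n x) 1 (fun _ _ => 0) (fun _ _ => 0)].
  move=> n0; have no (u : 'I_(inst_n x)) : False by have := ltn_ord u; rewrite {2}n0.
  by split=> [u|u|u|u v|u v]; rewrite ?n0 //; case: (no u).
split.
(* The empty instance is realizable, so the answer there is 1. *)
- pose c := program_cmd (Print (Cst 1)) check_cmd.
  exists (compile c), 2, (fun n => cost n c 1 + 2), (space 11).
  split; [exact: bigO_cost|exact: bigO_space|move=> x w _ wl].
  apply: program_ok => // [nW W1 n0 B m' e hB he h2 hp|W1 n0].
    apply: check_cmd_ok => // m1 b hb.
    have FE : full (inst_n x) B (m' 2) (m' 9) <-> realizable x.
      rewrite -(full_realizable hB he (@arrays_of1 x) hp).
      by split=> F u v hu hv; have := F u v hu hv; rewrite h2.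
    by case: hb => -[-> /FE H]; split=> //.
  split=> //=; split=> // nr; case: nr.
  have [h1 h2 h3 h4 h5] := empty_ok x n0.
  exact: (full_realizable h1 h2 h3 h4).1 h5.
(* The realization of the empty instance has no labels, so nothing is printed. *)
- pose c := program_cmd Skip output_cmd.
  exists (compile c), 2, (fun n => cost n c 1 + 2), (space 11).
  split; [exact: bigO_cost|exact: bigO_space|move=> x w rx wl].
  apply: program_ok => // [nW W1 n0 B m' e hB he h2 hp|W1 n0].
    apply: output_cmd_ok => // [u v w' hu hv E|m1 S US hS].
      have [h _] := hp u v hu hv; have [hw [_ lt _ _]] := h _ E.
      split=> //; first by apply: contraTneq lt => ->; rewrite ltnn.
      by rewrite h2 //; lia.
    apply: (full_correct_realization hB he (@arrays_of1 x) hp) => //.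
      by apply/(full_realizable hB he (@arrays_of1 x) hp).
    move=> a b t; rewrite hS /lab; split=> -[u [v [w' [hu hv]]]].
      by rewrite h2 // => *; exists u, v, w'.
    by move=> *; exists u, v, w'; rewrite h2.
  have [h1 h2 h3 h4 h5] := empty_ok x n0.
  apply: (full_correct_realization (S := [::]) h1 h2 h3 h4) => // a b t; split=> //.
  by case=> u [v [w' [hu]]]; rewrite n0 in hu.
Qed.
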